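(* Let $r\ge2$ and let $T^{\pm}_t(x)\in\mathrm{End}(\mathbb C^{2r})^{\otimes N}$, $t\in\mathbb C$, be the analytically continued spinorial $D_r$-type transfer matrices. Then for any $t\in\mathbb C$ and either sign, $$T^{\pm}_t(x)=(-1)^{\frac{r(r-1)}2}\,T^{\pm(-1)^r}_{-r+1-t}(x).$$
   Context: $e_{ij}$ are matrix units, $\mathrm I_m$ the identity matrix, $N\ge0$ a fixed integer, $i'=2r+1-i$. Twist parameters: $\tau_i=e^{x_i}$, $\tau_i^s:=e^{sx_i}$, $1\le i\le r$, with $|\tau_1|>\dots>|\tau_r|>1$ (so that the traces below converge). Let $\mathcal A$ be the algebra generated by $\mathbf a_{j',i},\bar{\mathbf a}_{i,j'}$, $1\le i<j\le r$, with $[\mathbf a_{j',i},\bar{\mathbf a}_{k,\ell'}]=\delta_{ik}\delta_{j\ell}$ and all other commutators of generators zero; its Fock module $\mathsf F$ has basis the monomials in the $\bar{\mathbf a}_{i,j'}$ applied to $|0\rangle$, $\mathbf a_{j',i}|0\rangle=0$. $\bar{\mathbf A}$ is the $r\times r$ matrix with rows $i=1,\dots,r$ and columns labelled $r',(r-1)',\dots,1'$ left to right, with $(i,j')$ entry $\bar{\mathbf a}_{i,j'}$ if $i<j$, $0$ if $i=j$, $-\bar{\mathbf a}_{j,i'}$ if $i>j$. $\mathbf A$ has rows labelled $r',\dots,1'$ top to bottom and columns $1,\dots,r$, with $(j',i)$ entry $\mathbf a_{j',i}$ if $i<j$, $0$ if $i=j$, $-\mathbf a_{i',j}$ if $i>j$.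 For $t\in\mathbb C$, $$\mathcal L(x)=\begin{pmatrix}(x+t)\mathrm I_r-\bar{\mathbf A}\mathbf A&-\bar{\mathbf A}(2t+r-1-\mathbf A\bar{\mathbf A})\\-\mathbf A&(x-t-r+1)\mathrm I_r+\mathbf A\bar{\mathbf A}\end{pmatrix}.$$ $B_i=e_{ii'}+e_{i'i}+\sum_{j\le r,j\ne i}(e_{jj}+e_{j'j'})$, $B_{\vec\mu}=\prod_{j:\mu_j=-1}B_j$ for $\vec\mu\in\{\pm1\}^r$. $\mathcal L_{\vec\mu}(x)$ is $B_{\vec\mu}\mathcal L(x)B_{\vec\mu}^{-1}$ with the automorphism $\bar{\mathbf a}_{i,j'}\mapsto-\mathbf a_{j',i}$, $\mathbf a_{j',i}\mapsto\bar{\mathbf a}_{i,j'}$ applied for those $i<j$ with $\mu_i=-1$. Write $\mathcal L_{\vec\mu}(x)=x\mathrm I_{2r}+\sum_{i,j}e_{ij}\mathcal F^{\vec\mu}_{ji}$ and $$T^+_{\vec\mu,t}(x)=\mathrm{tr}_{\mathsf F}\prod_{i=1}^r\tau_i^{\mathcal F^{\vec\mu}_{ii}}\,\underbrace{\mathcal L_{\vec\mu}(x)\otimes\cdots\otimes\mathcal L_{\vec\mu}(x)}_N,$$ where $L\otimes\cdots\otimes L=\sum e_{i_1j_1}\otimes\cdots\otimes e_{i_Nj_N}L_{i_1j_1}\cdots L_{i_Nj_N}$. With $\mathsf l(\vec\mu)=\sum_{i:\mu_i=-1}(r-i)$ and $\{\pm1\}^r_{\pm}=\{\vec\mu\in\{\pm1\}^r:\mu_1\cdots\mu_r=\pm1\}$,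 the analytically continued transfer matrices are $T^\pm_t(x)=\sum_{\vec\mu\in\{\pm1\}^r_\pm}(-1)^{\mathsf l(\vec\mu)}T^+_{\vec\mu,t}(x)$ for all $t\in\mathbb C$. (For $t\in\frac12\mathbb N$ these equal the transfer matrices with trace over the irreducible finite-dimensional $\mathfrak{so}_{2r}$-modules $L^+_t=L_{2t\omega_r}$, $L^-_t=L_{2t\omega_{r-1}}$.) The superscript $\pm(-1)^r$ means the sign $\pm$ if $r$ is even and $\mp$ if $r$ is odd. *)

(* Defs.v *)
From HB Require Import structures.
From mathcomp Require Import all_boot all_order all_fingroup all_algebra.
From mathcomp Require Import boolp classical_sets reals topology normedtype.
From mathcomp Require Import sequences exp trigo.
From mathcomp Require Import complex.
From mathcomp Require summability.
(* The notations of mpoly clash with those of mathcomp-analysis. *)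
From mathcomp Require Import -(notations) mpoly.

Set Implicit Arguments.
Unset Strict Implicit.
Unset Printing Implicit Defensive.

Import Order.TTheory GRing.Theory Num.Theory.
Import numFieldNormedType.Exports.

Local Open Scope ring_scope.

Section Endomorphisms.
Variables (K : comNzRingType) (V : lalgType K).

(* The algebra of linear endomorphisms of V, with composition as product.
   V is an algebra only so that it is nontrivial, i.e. [1 != 0] in [endo]. *)
Definition endo : Type := {linear V -> V}.
Implicit Types f g h : endo.

HB.instance Definition _ := gen_eqMixin endo.
HB.instance Definition _ := gen_choiceMixin endo.

Lemma endoP f g : (forall v, f v = g v) -> f = g.
Proof.
case: f g => [f [[[f0 fD]] [fZ]]] [g [[[g0 gD]] [gZ]]] /= efg.
have {}efg : f = g by apply/funext.
subst g.
by rewrite (Prop_irrelevance f0 g0) (Prop_irrelevance fD gD)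
  (Prop_irrelevance fZ gZ).
Qed.

Let endo0 : endo := \0.
Let endo1 : endo := idfun.
Let endoD f g : endo := f \+ g.
Let endoN f : endo := \- f.
Let endoM f g : endo := f \o g.
Let endoZ (c : K) f : endo := c \*: f.

Fact endo_addA : associative endoD.
Proof. by move=> f g h; apply: endoP => v /=; rewrite addrA. Qed.
Fact endo_addC : commutative endoD.
Proof. by move=> f g; apply: endoP => v /=; rewrite addrC. Qed.
Fact endo_add0 : left_id endo0 endoD.
Proof. by move=> f; apply: endoP => v /=; rewrite add0r. Qed.
Fact endo_addN : left_inverse endo0 endoN endoD.
Proof. by move=> f; apply: endoP => v /=; rewrite addNr. Qed.
HB.instance Definition _ :=
  GRing.isZmodule.Build endo endo_addA endo_addC endo_add0 endo_addN.

Fact endo_mulA : associative endoM.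
Proof. by move=> f g h; apply: endoP. Qed.
Fact endo_mul1 : left_id endo1 endoM.
Proof. by move=> f; apply: endoP. Qed.
Fact endo_mulr1 : right_id endo1 endoM.
Proof. by move=> f; apply: endoP. Qed.
Fact endo_mulDl : left_distributive endoM +%R.
Proof. by move=> f g h; apply: endoP. Qed.
Fact endo_mulDr : right_distributive endoM +%R.
Proof. by move=> f g h; apply: endoP => v /=; exact: linearD. Qed.
Fact endo_oner_neq0 : endo1 != 0 :> endo.
Proof.
apply/eqP => e10; have: (endo1 : V -> V) 1 = (0 : endo) 1 by rewrite e10.
by move/eqP; rewrite (oner_eq0 V).
Qed.
HB.instance Definition _ :=
  GRing.Zmodule_isNzRing.Build endo endo_mulA endo_mul1 endo_mulr1
    endo_mulDl endo_mulDr endo_oner_neq0.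

Fact endo_scaleA a b f : endoZ a (endoZ b f) = endoZ (a * b) f.
Proof. by apply: endoP => v /=; rewrite scalerA. Qed.
Fact endo_scale1 : left_id 1 endoZ.
Proof. by move=> f; apply: endoP => v /=; rewrite scale1r. Qed.
Fact endo_scaleDr : right_distributive endoZ +%R.
Proof. by move=> a f g; apply: endoP => v /=; rewrite scalerDr. Qed.
Fact endo_scaleDl f : {morph endoZ^~ f : a b / a + b}.
Proof. by move=> a b; apply: endoP => v /=; rewrite scalerDl. Qed.
HB.instance Definition _ :=
  GRing.Zmodule_isLmodule.Build K endo endo_scaleA endo_scale1
    endo_scaleDr endo_scaleDl.

Fact endo_scaleAl (a : K) f g : a *: (f * g) = (a *: f) * g.
Proof. exact: endoP. Qed.
HB.instance Definition _ :=
  GRing.Lmodule_isLalgebra.Build K endo endo_scaleAl.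
Fact endo_scaleAr (a : K) f g : a *: (f * g) = f * (a *: g).
Proof. by apply: endoP => v /=; rewrite -linearZ. Qed.
HB.instance Definition _ :=
  GRing.Lalgebra_isAlgebra.Build K endo endo_scaleAr.

Lemma endoDE f g v : (f + g) v = f v + g v. Proof. by []. Qed.
Lemma endoNE f v : (- f) v = - f v. Proof. by []. Qed.
Lemma endoME f g v : (f * g) v = f (g v). Proof. by []. Qed.
Lemma endo1E v : (1 : endo) v = v. Proof. by []. Qed.
Lemma endo0E v : (0 : endo) v = 0. Proof. by []. Qed.
Lemma endoZE c f v : (c *: f) v = c *: f v. Proof. by []. Qed.

Lemma endo_sumE (I : Type) (s : seq I) (P : pred I) (F : I -> endo) v :
  (\sum_(i <- s | P i) F i) v = \sum_(i <- s | P i) F i v.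
Proof. by elim/big_rec2: _ => [|i y1 y2 _ <-]. Qed.

End Endomorphisms.

(* Signs are booleans: [b] stands for [(-1) ^+ b].  Vectors and matrices of
   size 2r are indexed by ['I_(r + r)], with the 1-based label i <= r at
   [lshift r i] and the label i' = 2r + 1 - i at [primed i]. *)
Definition signs (r : nat) : finType := {ffun 'I_r -> bool}.

Definition primed (r : nat) (i : 'I_r) : 'I_(r + r) := rev_ord (lshift r i).

(* The pairs (i, j) with i < j, one for each canonical pair
   a_{j',i}, abar_{i,j'} of generators. *)
Definition osc (r : nat) : finType := {p : 'I_r * 'I_r | (p.1 < p.2)%N}.

Section Lax.
Variables (K : fieldType) (E : algType K) (r : nat).

Definition antisym (g : osc r -> E) (i j : 'I_r) : E :=
  if insub (i, j) is Some p then g p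
  else if insub (j, i) is Some p then - g p else 0.

(* The columns of Abar, and the rows of A, are labelled r', ..., 1' in this
   order, hence [rev_ord]. *)
Definition Abar_mx (ab : osc r -> E) : 'M[E]_r :=
  \matrix_(i, q) antisym ab i (rev_ord q).

Definition A_mx (a : osc r -> E) : 'M[E]_r :=
  \matrix_(q, i) antisym a i (rev_ord q).

Definition Lax (t x : K) (a ab : osc r -> E) : 'M[E]_(r + r) :=
  let A := A_mx a in
  let Ab := Abar_mx ab in
  block_mx
    ((x + t)%:A%:M - Ab *m A)
    (- (Ab *m ((2 * t + r%:R - 1)%:A%:M - A *m Ab)))
    (- A)
    ((x - t - r%:R + 1)%:A%:M + A *m Ab).

Definition B_mx (i : 'I_r) : 'M[K]_(r + r) :=
  delta_mx (lshift r i) (primed i) + delta_mx (primed i) (lshift r i)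
  + \sum_(j < r | j != i)
      (delta_mx (lshift r j) (lshift r j) + delta_mx (primed j) (primed j)).

Definition B_sign (mu : signs r) : 'M[K]_(r + r) := \prod_(j | mu j) B_mx j.

Definition ccr (a ab : osc r -> E) : Prop :=
  [/\ forall p q, a p * ab q - ab q * a p = (p == q)%:R,
      forall p q, a p * a q = a q * a p
    & forall p q, ab p * ab q = ab q * ab p].

(* The images of the generators a, abar under the automorphism
   abar_{i,j'} |-> - a_{j',i}, a_{j',i} |-> abar_{i,j'} for mu_i = -1. *)
Definition flip_a (mu : signs r) (a ab : osc r -> E) (p : osc r) : E :=
  if mu (val p).1 then ab p else a p.

Definition flip_abar (mu : signs r) (a ab : osc r -> E) (p : osc r) : E :=
  if mu (val p).1 then - a p else ab p.

Lemma flip_ccr mu (a ab : osc r -> E) :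
  ccr a ab -> ccr (flip_a mu a ab) (flip_abar mu a ab).
Proof.
case=> c ca cab.
have neq p q : mu (val p).1 != mu (val q).1 -> (p == q) = false.
  by apply: contraNF => /eqP ->.
have cc p q : mu (val p).1 != mu (val q).1 -> a p * ab q = ab q * a p.
  by move=> /neq npq; apply/subr0_eq; rewrite c npq.
rewrite /flip_a /flip_abar.
split=> p q; case mp: (mu (val p).1); case mq: (mu (val q).1) => //.
- by rewrite mulrN mulNr opprK addrC c eq_sym.
- by rewrite neq ?mp ?mq // cab subrr.
- by rewrite neq ?mp ?mq // mulrN mulNr opprK ca addNr.
- by rewrite cc ?mp ?mq.
- by rewrite cc ?mp ?mq.
- by rewrite !mulrNN ca.
- by rewrite mulNr mulrN cc ?mp ?mq.
- by rewrite mulNr mulrN cc ?mp ?mq.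
Qed.

(* L_mu(x).  The entries of [Lax] are polynomials in the generators, so
   the automorphism is applied by substituting the images of the generators
   (see [Lax_map]); it fixes the scalar matrices B_mu. *)
Definition Lax_sign (mu : signs r) (t x : K) (a ab : osc r -> E) :
    'M[E]_(r + r) :=
  map_mx (in_alg E) (B_sign mu)
  *m Lax t x (flip_a mu a ab) (flip_abar mu a ab)
  *m map_mx (in_alg E) (invmx (B_sign mu)).

(* The generators F^mu_{ji} with L_mu(x) = x I_2r + sum_ij e_ij F^mu_{ji}. *)
Definition F_sign (mu : signs r) (t : K) (a ab : osc r -> E) :
    'M[E]_(r + r) :=
  (Lax_sign mu t 0 a ab)^T.

End Lax.

Lemma Lax_map (K : fieldType) (E E' : algType K) (r : nat)
    (phi : {lrmorphism E -> E'}) (t x : K) (a ab : osc r -> E) :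
  map_mx phi (Lax t x a ab) = Lax t x (phi \o a) (phi \o ab).
Proof.
have anti g i j : phi (antisym g i j) = antisym (phi \o g) i j.
  rewrite /antisym; case: insub => //=; case: insub => [p|] /=.
    by rewrite rmorphN.
  by rewrite rmorph0.
have mA : map_mx phi (A_mx a) = A_mx (phi \o a).
  by apply/matrixP => i j; rewrite !mxE anti.
have mAb : map_mx phi (Abar_mx ab) = Abar_mx (phi \o ab).
  by apply/matrixP => i j; rewrite !mxE anti.
have alg c : phi c%:A = c%:A by rewrite linearZ /= rmorph1.
rewrite /Lax map_block_mx; congr block_mx.
- by rewrite map_mxB map_mxM map_scalar_mx /= alg mA mAb.
- by rewrite map_mxN map_mxM map_mxB map_mxM map_scalar_mx /= alg mA mAb.
- by rewrite map_mxN mA.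
- by rewrite map_mxD map_mxM map_scalar_mx /= alg mA mAb.
Qed.

Section LaxTheory.
Variables (K : fieldType) (E : algType K) (r : nat).
Implicit Types (a ab : osc r -> E) (mu : signs r).

Lemma B_mxE i : B_mx K i = tperm_mx (lshift r i) (primed i).
Proof.
have ndl (j k : 'I_r) : (lshift r j == primed k) = false.
  apply/negP => /eqP /(congr1 val) /=; rewrite -addnBA ?ltn_ord // => e.
  by have := ltn_ord j; rewrite e ltnNge leq_addr.
have prI (j k : 'I_r) : (primed j == primed k) = (j == k).
  by rewrite (inj_eq rev_ord_inj) (inj_eq (@lshift_inj _ _)).
have lI (j k : 'I_r) : (lshift r j == lshift r k) = (j == k).
  by rewrite (inj_eq (@lshift_inj _ _)).
apply/matrixP => p q; rewrite /B_mx !mxE summxE.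
under eq_bigr do rewrite !mxE.
have [j [->|->]] : exists j : 'I_r, p = lshift r j \/ p = primed j.
  case: (split_ordP p) => j ->; first by exists j; left.
  exists (rev_ord j); right; apply/val_inj => /=.
  by rewrite subnSK // subnBA 1?ltnW // addnAC addnK.
- rewrite lI ndl /= addr0; under eq_bigr do rewrite lI ndl /= addr0.
  case: tpermP => [/lshift_inj ->|/eqP|/eqP].
  + rewrite eqxx /= big1 ?addr0 1?eq_sym // => k nk.
    by rewrite eq_sym (negPf nk).
  + by rewrite ndl.
  + rewrite lI => nji _; rewrite (negPf nji) /= add0r.
    rewrite (bigD1 j) //= eqxx /= big1 ?addr0 1?eq_sym // => k /andP[_ nk].
    by rewrite eq_sym (negPf nk).
- have ndr (k : 'I_r) : (primed j == lshift r k) = false.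
    by rewrite eq_sym ndl.
  rewrite ndr prI /= add0r; under eq_bigr do rewrite ndr prI /= add0r.
  case: tpermP => [/eqP|/rev_ord_inj/lshift_inj ->|_ /eqP].
  + by rewrite ndr.
  + rewrite eqxx /= big1 ?addr0 1?eq_sym // => k nk.
    by rewrite eq_sym (negPf nk).
  + rewrite prI => nji; rewrite (negPf nji) /= add0r.
    rewrite (bigD1 j) //= eqxx /= big1 ?addr0 1?eq_sym // => k /andP[_ nk].
    by rewrite eq_sym (negPf nk).
Qed.

Lemma B_signE mu : exists s : 'S_(r + r), B_sign K mu = perm_mx s.
Proof.
rewrite /B_sign; elim/big_ind: _ => [|_ _ [s ->] [s' ->]|i _].
- by exists 1%g; rewrite perm_mx1.
- by exists (s * s')%g; rewrite perm_mxM.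
- by exists (tperm (lshift r i) (primed i)); rewrite B_mxE.
Qed.

Lemma B_sign_unit mu : B_sign K mu \in unitmx.
Proof. by have [s ->] := B_signE mu; exact: unitmx_perm. Qed.

Lemma Lax0E t x a ab : Lax t x a ab = x%:A%:M + Lax t 0 a ab.
Proof.
rewrite /Lax (scalar_mx_block (r : nat) r) add_block_mx !add0r !addrA.
by congr block_mx; rewrite -raddfD -scalerDl ?addrA ?addr0 ?add0r.
Qed.

Lemma Lax_signE mu t x a ab :
  Lax_sign mu t x a ab = x%:A%:M + (F_sign mu t a ab)^T.
Proof.
rewrite /F_sign trmxK /Lax_sign Lax0E mulmxDr mulmxDl; congr (_ + _).
rewrite -[x%:A%:M](map_scalar_mx (in_alg E)) -!map_mxM.
rewrite scalar_mxC.
by rewrite -mulmxA mulmxV ?B_sign_unit // mulmx1.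
Qed.

Lemma F_sign_diag mu t a ab i : exists j,
  F_sign mu t a ab i i = Lax t 0 (flip_a mu a ab) (flip_abar mu a ab) j j.
Proof.
have [s Bs] := B_signE mu; exists (s i).
have invs : invmx (perm_mx s) = perm_mx s^-1 :> 'M[K]_(r + r).
  by rewrite -[LHS]mulmx1 -perm_mx1 -(mulgV s) perm_mxM mulKmx ?unitmx_perm.
rewrite /F_sign mxE /Lax_sign Bs invs.
by rewrite !map_perm_mx -row_permE -col_permE !mxE.
Qed.

End LaxTheory.

Section Fock.
Variables (R : realType) (r : nat).
Local Notation C := R[i].

Definition cexp (z : C) : C :=
  Complex (expR (complex.Re z) * cos (complex.Im z))
          (expR (complex.Re z) * sin (complex.Im z)).

(* The Fock module: polynomials in the abar_{i,j'}, on which abar_{i,j'} acts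
   by multiplication and a_{j',i} by differentiation, with |0> = 1. *)
Definition Fock : algType C := mpoly #|osc r| C.
Definition state : choiceType := multinom #|osc r|.
Definition basis (m : state) : Fock := mpolyX C m.
Definition coord (m : state) (v : Fock) : C := mcoeff m v.

Definition cre_fun (p : osc r) (v : Fock) : Fock :=
  mpolyX C (mnm1 (enum_rank p)) * v.

Fact cre_fun_linear p : linear (cre_fun p).
Proof. by move=> c u v; rewrite /cre_fun mulrDr scalerAr. Qed.
HB.instance Definition _ p :=
  GRing.isLinear.Build C Fock Fock *:%R (cre_fun p) (cre_fun_linear p).

Definition cre (p : osc r) : endo Fock := cre_fun p.
Definition ann (p : osc r) : endo Fock :=
  (mderiv (enum_rank p) : {linear Fock -> Fock}).

Lemma fock_ccr : ccr ann cre.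
Proof.
split=> p q; apply: endoP => v.
- rewrite endoDE endoNE !endoME /ann /cre /= /cre_fun mderivM addrK.
  rewrite mderivX mnm1E (inj_eq enum_rank_inj) eq_sym.
  case: eqP => [->|_]; last by rewrite scale0r mul0r.
  rewrite scale1r (_ : mnm_sub _ _ = mnm0) ?mpolyX0 ?mul1r //.
  by apply/mnmP => k; rewrite mnmBE mnm0E subnn.
- by rewrite !endoME /= mderiv_comm.
- by rewrite !endoME /= /cre_fun mulrCA.
Qed.

Lemma ann_vacuum p : ann p 1 = 0.
Proof. exact: mderivC. Qed.

(* e^(c D), for an operator D that is diagonal in the monomial basis (meaningless
   otherwise).  It is only applied to F^mu_{ii}: see [F_op_diagonal]. *)
Definition exp_diag_fun (c : C) (D : endo Fock) (v : Fock) : Fock :=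
  \sum_(m <- msupp v) (coord m v * cexp (c * coord m (D (basis m)))) *: basis m.

Lemma coord_exp_diag c D v m :
  coord m (exp_diag_fun c D v) = coord m v * cexp (c * coord m (D (basis m))).
Proof.
rewrite /exp_diag_fun /coord raddf_sum /=.
under eq_bigr do rewrite mcoeffZ mcoeffX.
case: (boolP (m \in msupp v)) => [mv|/[dup] mv /memN_msupp_eq0 ->].
  rewrite (bigD1_seq m) ?msupp_uniq //= eqxx mulr1 big1 ?addr0 // => k nk.
  by rewrite (negPf nk) mulr0.
rewrite mul0r big_seq big1 // => k kv; case: eqP => [ek|_]; last exact: mulr0.
by rewrite -ek kv in mv.
Qed.

Fact exp_diag_fun_linear c D : linear (exp_diag_fun c D).
Proof.
move=> k u v; apply/mpolyP => m.
have coordD (b : C) (y z : Fock) : coord m (b *: y + z) = b * coord m y + coord m z.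
  by rewrite /coord mcoeffD mcoeffZ.
rewrite -![mcoeff m _]/(coord m _) coordD !coord_exp_diag coordD.
by rewrite mulrDl mulrA.
Qed.
HB.instance Definition _ c D :=
  GRing.isLinear.Build C Fock Fock *:%R (exp_diag_fun c D)
    (exp_diag_fun_linear c D).

Definition exp_diag (c : C) (D : endo Fock) : endo Fock := exp_diag_fun c D.

(* The sum over the monomial basis is the limit of the net of finite partial
   sums (unconditional summation), for the norm topology of C. *)
Definition fock_trace (D : endo Fock) : C :=
  summability.sum (fun m : state => coord m (D (basis m)) : C^o).

Definition diagonal (D : endo Fock) : Prop :=
  forall m, exists c, D (basis m) = c *: basis m.

Lemma exp_diag_basis c (D : endo Fock) m d :
  D (basis m) = d *: basis m ->
  exp_diag c D (basis m) = cexp (c * d) *: basis m.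
Proof.
move=> Dm; apply/mpolyP => k; rewrite -![mcoeff k _]/(coord k _).
rewrite coord_exp_diag /coord mcoeffZ mcoeffX; case: eqP => [<-|_].
  by rewrite Dm mcoeffZ mcoeffX eqxx !mulr1 mul1r.
by rewrite mul0r mulr0.
Qed.

Section Transfer.
(* [xs i] is x_i, with tau_i = e^(x_i). *)
Variables (N : nat) (xs : 'I_r -> C).
Implicit Types (mu : signs r) (t x : C) (s : bool).

Definition L_op mu t x : 'M[endo Fock]_(r + r) := Lax_sign mu t x ann cre.
Definition F_op mu t : 'M[endo Fock]_(r + r) := F_sign mu t ann cre.

Lemma F_op_diagonal mu t i : diagonal (F_op mu t i i).
Proof.
have [j ->] := F_sign_diag mu t ann cre i.
have diag0 : diagonal 0 by move=> m; exists 0; rewrite scale0r.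
have diagD D1 D2 : diagonal D1 -> diagonal D2 -> diagonal (D1 + D2).
  move=> h1 h2 m; have [c1 e1] := h1 m; have [c2 e2] := h2 m.
  by exists (c1 + c2); rewrite endoDE e1 e2 scalerDl.
have diagN D : diagonal D -> diagonal (- D).
  by move=> h m; have [c e] := h m; exists (- c); rewrite endoNE e scaleNr.
have diagc c : diagonal c%:A by move=> m; exists c.
have diagca p : diagonal (cre p * ann p).
  move=> m; exists (m (enum_rank p))%:R.
  rewrite endoME /= /cre_fun mderivX -scalerAr -mpolyXD addmC.
  case: (posnP (m (enum_rank p))) => [->|mp]; first by rewrite !scale0r.
  by rewrite submK // lep1mP -lt0n.
have diagac p : diagonal (ann p * cre p).
  have [cc _ _] := fock_ccr; have := cc p p.
  move/eqP; rewrite subr_eq eqxx => /eqP ->; apply: diagD (diagca p).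
  by move=> m; exists 1; rewrite scale1r.
set a := flip_a _ _ _; set ab := flip_abar _ _ _.
have dpair p : diagonal (ab p * a p) /\ diagonal (a p * ab p).
  rewrite /a /ab /flip_a /flip_abar; case: ifP => _; last by split.
  by rewrite mulNr mulrN; split; apply: diagN.
have danti k l : diagonal (antisym ab k l * antisym a k l)
    /\ diagonal (antisym a k l * antisym ab k l).
  rewrite /antisym; case: insub => [p|]; first exact: dpair.
  case: insub => [p|]; last by rewrite mul0r.
  by rewrite !mulrNN; exact: dpair.
have diag_sum (F : 'I_r -> endo Fock) :
    (forall k, diagonal (F k)) -> diagonal (\sum_k F k).
  by move=> dF; elim/big_ind: _.
have anti_swap (g : osc r -> endo Fock) k l : antisym g k l = - antisym g l k.
  rewrite /antisym; case: insubP => [[[? ?] lt1] _ /= [e1 e2]|].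
    case: insubP => [[[? ?] lt2] _ /= [e3 e4]|_].
      by subst; have := ltn_trans lt1 lt2; rewrite ltnn.
    by rewrite opprK.
  by case: insubP => [p _ _|_] _; rewrite ?opprK ?oppr0.
case: (split_ordP j) => k ->.
- rewrite block_mxEul; rewrite !mxE; apply: diagD; first by rewrite eqxx; exact: diagc.
  apply/diagN/diag_sum => l; rewrite !mxE.
  exact: (danti _ _).1.
- rewrite block_mxEdr; rewrite !mxE; apply: diagD; first by rewrite eqxx; exact: diagc.
  apply/diag_sum => l; rewrite !mxE.
  exact: (danti _ _).2.
Qed.

(* T^+_{mu,t}(x), as a matrix in the basis e_{i_1} (x) ... (x) e_{i_N} of
   (C^2r)^{(x) N}. *)
Definition T_sign mu t x : 'M[C]_#|{: N.-tuple 'I_(r + r)}| :=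
  \matrix_(p, q)
    fock_trace
      (\prod_(i < r)
          exp_diag (xs i) (F_op mu t (lshift r i) (lshift r i))
       * \prod_(k < N)
           L_op mu t x (tnth (enum_val p) k) (tnth (enum_val q) k)).

Definition ell mu : nat := \sum_(i < r | mu i) (r - i.+1).

(* T^+_t(x) for [s = false] and T^-_t(x) for [s = true]. *)
Definition T_spin s t x : 'M[C]_#|{: N.-tuple 'I_(r + r)}| :=
  \sum_(mu : signs r | \prod_(i < r) (-1) ^+ mu i == (-1) ^+ s :> int)
    (-1) ^+ ell mu *: T_sign mu t x.

End Transfer.
End Fock.

(* Main.v *)
Require Import Defs.
From mathcomp Require Import all_boot all_order all_fingroup all_algebra finmap.
From mathcomp Require Import boolp classical_sets reals topology normedtype.
From mathcomp Require Import exp.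
From mathcomp Require Import complex.
From mathcomp Require summability.
From mathcomp Require Import ring.
From mathcomp Require Import -(notations) mpoly.

(** The identity holds term by term.  Write [opposite mu] for the sign vector
- mu.  Then T_{mu, t}(x) = T_{- mu, 1 - r - t}(x), and the signs agree because
ell mu + ell (- mu) = r (r - 1) / 2 while the product of the signs of - mu is
(- 1)^r times that of mu.

The equality of two terms is an algebraic form of the fact that a trace is
determined by a character.  The entries of the Lax matrix [Lax_sign mu t x]
satisfy the commutation relations of so_2r, with structure constants that do
not involve mu, t or x ([Lax_sign_brackets]).  Let
f(W) = tr (prod_i tau_i^(F_ii) W).  This functional is cyclic up to a scalar,
f(L_pq W) = (w_q / w_p) f(W L_pq) with w_i = tau_i and w_i' = 1 / tau_i
([Lax_sign_twists]), and the inequalities |tau_1| > ... > |tau_r| > 1 make the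
w_p pairwise distinct ([label_weight_inj]).  Moving an off-diagonal entry once
around a word multiplies f by a scalar other than 1 up to commutators, which
are values of f on shorter words.  By induction f is determined on all words
by the diagonal entries alone ([twisted_trace_eq]).  Finally, the diagonal
entries for (mu, t) and for (- mu, 1 - r - t) are the same operators
([Lax_sign_diag_opposite]), and so the two functionals f coincide as well.

Analysis enters through f.  For a single oscillator the twisted cyclicity is a
reindexing of the monomial basis by the translation m |-> m + e_p
([cre_twists], [ann_twists]).  The entries of L are polynomials in the
oscillators, so that f must also be additive on the algebra that they
generate; there all traces converge absolutely.  Indeed the operators of that
algebra have matrix coefficients of polynomial growth ([tameM]), while the
eigenvalue of prod_i tau_i^(F_ii) decays geometrically ([twist_bound]): the
reflections attached to mu are such that each creation operator multiplies it
by a scalar of norm less than 1 ([osc_weight_lt1]). *)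

Set Implicit Arguments.
Unset Strict Implicit.
Unset Printing Implicit Defensive.

Import Order.TTheory GRing.Theory Num.Theory.
Import numFieldNormedType.Exports.
Local Open Scope ring_scope.

(** * Twisted cyclic functionals *)

Section TwistedTraces.
Variables (K : fieldType) (E : algType K).

(** A functional that is linear on a subalgebra A only: the Fock trace is
additive on operators for which it converges. *)
Record linear_on (A : E -> Prop) (f : E -> K) : Prop := LinearOn {
  dom1 : A 1;
  domD : forall X Y, A X -> A Y -> A (X + Y);
  domM : forall X Y, A X -> A Y -> A (X * Y);
  domZ : forall c X, A X -> A (c *: X);
  valD : forall X Y, A X -> A Y -> f (X + Y) = f X + f Y;
  valZ : forall c X, A X -> f (c *: X) = c * f X }.

Variables (A : E -> Prop) (f : E -> K).
Hypothesis lin : linear_on A f.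

Lemma dom0 : A 0.
Proof. by rewrite -(scale0r 1); apply: (domZ lin); exact: (dom1 lin). Qed.

Lemma domN X : A X -> A (- X).
Proof. by rewrite -scaleN1r; exact: (domZ lin). Qed.

Lemma dom_sum (I : Type) (s : seq I) (P : pred I) (F : I -> E) :
  (forall i, P i -> A (F i)) -> A (\sum_(i <- s | P i) F i).
Proof.
move=> AF; elim/big_ind: _ => //; [exact: dom0 | exact: (domD lin)].
Qed.

Lemma dom_prod (I : Type) (s : seq I) (F : I -> E) :
  (forall i, A (F i)) -> A (\prod_(i <- s) F i).
Proof.
move=> AF; elim/big_ind: _ => //; [exact: (dom1 lin) | exact: (domM lin)].
Qed.

Lemma val0 : f 0 = 0.
Proof. by rewrite -(scale0r 1) (valZ lin) ?mul0r //; exact: (dom1 lin). Qed.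

Lemma valB X Y : A X -> A Y -> f (X - Y) = f X - f Y.
Proof.
move=> AX AY; rewrite (valD lin) //; last exact: domN.
by rewrite -scaleN1r (valZ lin) // mulN1r.
Qed.

Lemma val_sum (I : Type) (s : seq I) (F : I -> E) :
  (forall i, A (F i)) -> f (\sum_(i <- s) F i) = \sum_(i <- s) f (F i).
Proof.
move=> AF; elim: s => [|i s IHs]; first by rewrite !big_nil val0.
by rewrite !big_cons (valD lin) ?IHs //; exact: dom_sum.
Qed.

(** For f(W) = tr(D W), this holds when D X = c X D. *)
Definition twists (c : K) (X : E) : Prop :=
  A X /\ forall W, A W -> f (X * W) = c * f (W * X).

Lemma twists0 c : twists c 0.
Proof. by split=> [|W _]; [exact: dom0 | rewrite mul0r mulr0 val0 mulr0]. Qed.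

Lemma twists1 : twists 1 1.
Proof. by split=> [|W _]; [exact: (dom1 lin) | rewrite mul1r mulr1 mul1r]. Qed.

Lemma twistsZ c k X : twists c X -> twists c (k *: X).
Proof.
move=> [AX tX]; split=> [|W AW]; first exact: (domZ lin).
have AXW : A (X * W) by exact: (domM lin).
have AWX : A (W * X) by exact: (domM lin).
by rewrite -scalerAl -scalerAr (valZ lin k AXW) (valZ lin k AWX) tX // mulrCA.
Qed.

Lemma twistsN c X : twists c X -> twists c (- X).
Proof. by rewrite -scaleN1r; exact: twistsZ. Qed.

Lemma twistsD c X Y : twists c X -> twists c Y -> twists c (X + Y).
Proof.
move=> [AX tX] [AY tY]; split=> [|W AW]; first exact: (domD lin).
have AM := domM lin.
rewrite mulrDl mulrDr (valD lin (AM _ _ AX AW) (AM _ _ AY AW)).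
by rewrite (valD lin (AM _ _ AW AX) (AM _ _ AW AY)) tX // tY // mulrDr.
Qed.

Lemma twists_sum c (I : Type) (s : seq I) (P : pred I) (F : I -> E) :
  (forall i, P i -> twists c (F i)) -> twists c (\sum_(i <- s | P i) F i).
Proof.
by move=> tF; elim/big_ind: _ => //; [exact: twists0 | move=> ? ?; exact: twistsD].
Qed.

Lemma twistsM c d X Y : twists c X -> twists d Y -> twists (c * d) (X * Y).
Proof.
move=> [AX tX] [AY tY]; split=> [|W AW]; first exact: (domM lin).
have AM := domM lin.
rewrite -mulrA (tX _ (AM _ _ AY AW)) -mulrA (tY _ (AM _ _ AW AX)).
by rewrite !mulrA.
Qed.

Lemma twists_prod (I : Type) (s : seq I) (c : I -> K) (F : I -> E) :
  (forall i, twists (c i) (F i)) ->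
  twists (\prod_(i <- s) c i) (\prod_(i <- s) F i).
Proof.
move=> tF; elim: s => [|i s IHs]; first by rewrite !big_nil; exact: twists1.
by rewrite !big_cons; exact: twistsM.
Qed.

(** Structure constants are sparse lists of coefficients and indices, so that
families over an arbitrary index type can share them. *)
Definition brackets (J : Type) (b : J -> J -> seq (K * J)) (M : J -> E) : Prop :=
  forall j k, M j * M k - M k * M j = \sum_(u <- b j k) u.1 *: M u.2.

Section Comparison.
Variables (J : Type) (b : J -> J -> seq (K * J)) (c : J -> K).
Variables M M' : J -> E.
Hypotheses (Mb : brackets b M) (M'b : brackets b M').
Hypotheses (tM : forall j, twists (c j) (M j)).
Hypotheses (tM' : forall j, twists (c j) (M' j)).
Hypothesis c1 : forall j, c j = 1 -> M j = M' j.

Let word (N : J -> E) (w : seq J) : E := \prod_(j <- w) N j.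

Let word_cat N w1 w2 : word N (w1 ++ w2) = word N w1 * word N w2.
Proof. by rewrite /word big_cat. Qed.

Let word_cons N j w : word N (j :: w) = N j * word N w.
Proof. by rewrite /word big_cons. Qed.

(* Leibniz rule: each bracket replaces two letters by one, so the right-hand
   side only involves words of length size w1 + size w2. *)
Let commutator_word N (Nb : brackets b N) (tN : forall j, twists (c j) (N j)) j w1 w2 :
  f (word N w1 * (N j * word N w2 - word N w2 * N j)) =
  \sum_(i < size w2) \sum_(u <- b j (nth j w2 i))
     u.1 * f (word N (w1 ++ take i w2 ++ u.2 :: drop i.+1 w2)).
Proof.
have AN w : A (word N w) by apply: dom_prod => k; case: (tN k).
have ANj k : A (N k) by case: (tN k).
have AM := domM lin.
elim: w2 w1 => [|k w2 IHw] w1.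
  by rewrite big_ord0 /word big_nil mulr1 mul1r subrr mulr0 val0.
have -> : word N w1 * (N j * word N (k :: w2) - word N (k :: w2) * N j) =
    word N w1 * (\sum_(u <- b j k) u.1 *: N u.2) * word N w2
    + word N (rcons w1 k) * (N j * word N w2 - word N w2 * N j).
  rewrite -Nb word_cons -cats1 word_cat word_cons /word big_nil mulr1.
  rewrite -!mulrA -mulrDr; congr (_ * _).
  by rewrite mulrBl mulrBr !mulrA addrA subrK.
rewrite (valD lin); first last.
- by apply: (AM) => //; apply: (domD lin); [|apply: domN]; exact: (AM).
- by apply: (AM) => //; apply: (AM) => //; apply: dom_sum => u _; exact: (domZ lin).
rewrite IHw big_ord_recl /= ?drop0; congr (_ + _).
  rewrite mulr_sumr mulr_suml val_sum => [|u]; last first.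
    by apply: (AM) => //; apply: (AM) => //; exact: (domZ lin).
  apply: eq_bigr => u _; rewrite word_cat word_cons -scalerAr -scalerAl (valZ lin).
    by rewrite !mulrA.
  by apply: (AM) => //; exact: (AM).
apply: eq_bigr => i _; apply: eq_bigr => u _.
by rewrite -cats1 -catA.
Qed.

(** Induction on the length of the word.  If c j <> 1, then
(1 - c j) f(M_j V) = - c j f([M_j, V]), and the right-hand side is a combination
of values on shorter words with coefficients common to M and M'.  A letter with
c j <> 1 can be rotated to the front; if there is none, then both words are the
same product. *)
Lemma twisted_trace_eq w :
  f (\prod_(j <- w) M j) = f (\prod_(j <- w) M' j).
Proof.
rewrite -!/(word _ _).
have [n] := ubnP (size w); elim: n => // n IHn in w *; rewrite ltnS => wn.
have rotw N (tN : forall j, twists (c j) (N j)) w1 w2 :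
    f (word N (w1 ++ w2)) = (\prod_(j <- w1) c j) * f (word N (w2 ++ w1)).
  rewrite !word_cat; apply: (twists_prod w1 tN).2.
  by apply: dom_prod => k; case: (tN k).
have headw j v : (size v < n)%N -> c j != 1 -> f (word M (j :: v)) = f (word M' (j :: v)).
  move=> vn cj.
  have key N (Nb : brackets b N) (tN : forall j, twists (c j) (N j)) :
      (1 - c j) * f (word N (j :: v)) =
      - (c j * f (word N [::] * (N j * word N v - word N v * N j))).
    have Av : A (word N v) by apply: dom_prod => k; case: (tN k).
    have [Aj tj] := tN j; have AM := domM lin.
    rewrite {2}/word big_nil mul1r valB; [|exact: (AM)..].
    rewrite word_cons mulrBl mul1r mulrBr opprB.
    by rewrite -(tj _ Av).
  apply: (@mulfI _ (1 - c j)); first by rewrite subr_eq0 eq_sym.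
  rewrite (key _ Mb tM) (key _ M'b tM') !commutator_word //.
  congr (- (_ * _)); apply: eq_bigr => i _; apply: eq_bigr => u _.
  congr (_ * _); apply: IHn; rewrite /= size_cat size_take ltn_ord /= size_drop.
  by rewrite subnSK // subnKC // ltnW.
have [[w1 [j [w2 [ew cj]]]]|allc] :
    (exists w1 j w2, w = w1 ++ j :: w2 /\ c j != 1) \/ word M w = word M' w.
- elim: (w) => [|k v [[w1 [j [w2 [-> cj]]]]|e]]; first by right; rewrite /word !big_nil.
    by left; exists (k :: w1), j, w2.
  have [ck|ck] := eqVneq (c k) 1; last by left; exists [::], k, v.
  by right; rewrite !word_cons e (c1 ck).
- rewrite ew in wn *; rewrite (rotw _ tM) (rotw _ tM') /= headw // size_cat addnC.
  by move: wn; rewrite size_cat /= addnS.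
by rewrite allc.
Qed.

End Comparison.
End TwistedTraces.

(** * Commutation relations of the orthogonal Lie algebra *)

Local Notation "[' X , Y ]" := (X * Y - Y * X) (format "[' X ,  Y ]").

Section Commutators.
Variables (K : fieldType) (E : algType K).
Implicit Types X Y Z : E.

Lemma commC X Y : [' X, Y] = - [' Y, X].
Proof. by rewrite opprB. Qed.

Lemma commMr X Y Z : [' X, Y * Z] = [' X, Y] * Z + Y * [' X, Z].
Proof. by rewrite mulrBl mulrBr !mulrA addrA subrK. Qed.

Lemma commDr X Y Z : [' X, Y + Z] = [' X, Y] + [' X, Z].
Proof. by rewrite mulrDl mulrDr opprD addrACA. Qed.

Lemma commNr X Y : [' X, - Y] = - [' X, Y].
Proof. by rewrite mulrN mulNr opprB opprK addrC. Qed.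

Lemma commZr c X Y : [' X, c *: Y] = c *: [' X, Y].
Proof. by rewrite -scalerAl -scalerAr scalerBr. Qed.

Lemma comm_sumr (I : finType) X (F : I -> E) :
  [' X, \sum_k F k] = \sum_k [' X, F k].
Proof. by rewrite mulr_sumr mulr_suml sumrB. Qed.

Lemma comm_algl c X Y : [' c%:A - X, Y] = - [' X, Y].
Proof.
by rewrite mulrBl mulrBr mulr_algl mulr_algr !opprB addrC subrKA.
Qed.

Lemma comm_algr c X Y : [' X, c%:A - Y] = - [' X, Y].
Proof. by rewrite mulrBl mulrBr mulr_algl mulr_algr !opprB addrC subrKA. Qed.

End Commutators.

Section Brackets.
Variables (K : fieldType) (E : algType K) (r : nat).

(** The bracket of so_2r in split form, where i |-> i' is [rev_ord]: for
X = F^T, it is the relation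
[F_ij, F_kl] = d_jk F_il - d_il F_kj - d_ik' F_j'l + d_jl' F_ki'. *)
Definition so_bracket (p q : 'I_(r + r) * 'I_(r + r)) :
    seq (K * ('I_(r + r) * 'I_(r + r))) :=
  [:: (- (p.2 == q.1)%:R, (p.1, q.2)); ((p.1 == q.2)%:R, (q.1, p.2));
      ((p.2 == rev_ord q.2)%:R, (p.1, rev_ord q.1));
      (- (p.1 == rev_ord q.1)%:R, (rev_ord q.2, p.2))].

Section Relations.
Variable X : 'I_(r + r) * 'I_(r + r) -> E.
Hypothesis X_antisym : forall p q, X (p, q) = - X (rev_ord q, rev_ord p).

Let rel p q := X p * X q - X q * X p = \sum_(u <- so_bracket p q) u.1 *: X u.2.

Let rev_eq p q : (rev_ord p == q :> 'I_(r + r)) = (p == rev_ord q).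
Proof. by rewrite -(inj_eq rev_ord_inj) rev_ordK. Qed.

Let eq_rev p q : (p == rev_ord q :> 'I_(r + r)) = (q == rev_ord p).
Proof. by rewrite eq_sym rev_eq. Qed.

Let X_rr p q : X (rev_ord q, rev_ord p) = - X (p, q).
Proof. by rewrite (X_antisym p) opprK. Qed.

Let X_r p q : X (q, rev_ord p) = - X (p, rev_ord q).
Proof. by rewrite X_antisym rev_ordK. Qed.

Let X_l p q : X (rev_ord q, p) = - X (rev_ord p, q).
Proof. by rewrite X_antisym rev_ordK. Qed.

(** Skew-symmetry X_pq = - X_q'p' makes the relation invariant under exchanging
the two generators, and under replacing the labels (p, q) of one of them by
(q', p').  Of the sixteen pairs of blocks, six remain. *)
Lemma bracket_sym p q : rel p q -> rel q p.
Proof.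
case: p q => [p1 p2] [q1 q2]; rewrite /rel !(big_cons, big_nil) /= !addr0 => e.
rewrite commC {}e (X_r p1) (X_l q2).
rewrite !scaleNr !scalerN !opprD !opprK addrCA.
by rewrite (eq_sym q1 p2) (eq_sym q2 p1) (eq_rev q1) (eq_rev q2).
Qed.

Lemma bracket_rev p1 p2 q : rel (p1, p2) q -> rel (rev_ord p2, rev_ord p1) q.
Proof.
case: q => [q1 q2]; rewrite /rel !(big_cons, big_nil) /= !addr0 => e.
rewrite X_rr mulrN mulNr -opprD {}e !X_rr (X_r p1) (X_l q2).
rewrite !scaleNr !scalerN !opprD !opprK.
rewrite !rev_eq !rev_ordK.
by rewrite [RHS]addrC -!addrA [LHS]addrCA [RHS]addrCA; congr (_ + _); rewrite addrCA.
Qed.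

End Relations.
End Brackets.

Section Labels.
Variable r : nat.
Implicit Types (i : 'I_r) (p : 'I_(r + r)).

Lemma primedE i : primed i = rshift r (rev_ord i).
Proof. by apply/val_inj => /=; rewrite -addnBA. Qed.

Definition label p : 'I_r :=
  match split p with inl i => i | inr j => rev_ord j end.

Lemma label_lshift i : label (lshift r i) = i.
Proof. by rewrite /label -[lshift r i]/(unsplit (inl i)) unsplitK. Qed.

Lemma label_primed i : label (primed i) = i.
Proof.
by rewrite /label primedE -[rshift r _]/(unsplit (inr _)) unsplitK rev_ordK.
Qed.

Lemma labelP p : p = lshift r (label p) \/ p = primed (label p).
Proof.
case: (split_ordP p) => j ->; first by left; rewrite label_lshift.
have -> : rshift r j = primed (rev_ord j) by rewrite primedE rev_ordK.
by right; rewrite label_primed.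
Qed.

Lemma label_rev p : label (rev_ord p) = label p.
Proof.
case: (labelP p) => ->; last by rewrite rev_ordK label_lshift label_primed.
by rewrite label_lshift -[rev_ord _]/(primed _) label_primed.
Qed.

End Labels.

Section Orthogonal.
Variables (K : fieldType) (E : algType K) (r : nat).
Implicit Types (X Y Z : E) (i j k l m : 'I_r).

Local Notation d i j := ((i == j)%:R : K).

Lemma sum_delta i (F : 'I_r -> E) : \sum_m d i m *: F m = F i.
Proof.
rewrite (bigD1 i) //= eqxx scale1r big1 ?addr0 // => m /negPf mi.
by rewrite eq_sym mi scale0r.
Qed.

Lemma antisym_lt i j : (i < j)%N ->
  exists p : osc r, val p = (i, j) /\
    forall g : osc r -> E, antisym g i j = g p /\ antisym g j i = - g p.
Proof.
move=> ij; exists (Sub (i, j) ij); split=> // g; rewrite /antisym.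
rewrite insubT; case: insubP => // [[? ji] /=]; first by rewrite ltnNge ltnW.
Qed.

Lemma antisym_diag (g : osc r -> E) i : antisym g i i = 0.
Proof. by rewrite /antisym !insubN //= ltnn. Qed.

Lemma antisymN (g : osc r -> E) i j : antisym g i j = - antisym g j i.
Proof.
have [ij|ji|/val_inj ->] := ltngtP i j; last by rewrite !antisym_diag oppr0.
  by have [p [_ /(_ g) [-> ->]]] := antisym_lt ij; rewrite opprK.
by have [p [_ /(_ g) [-> ->]]] := antisym_lt ji.
Qed.

Variables a ab : osc r -> E.
Hypothesis cc : ccr a ab.

Local Notation al := (antisym a).
Local Notation be := (antisym ab).

Lemma antisym_commute (g : osc r -> E) :
    (forall p q, g p * g q = g q * g p) ->
  forall i j k l, antisym g i j * antisym g k l = antisym g k l * antisym g i j.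
Proof.
move=> gC i j k l.
have values (P : E -> Prop) u v :
    (forall p, P (g p)) -> (forall p, P (- g p)) -> P 0 -> P (antisym g u v).
  rewrite /antisym; case: insub => [p|] Pg PNg P0 //.
  by case: insub => [p|].
apply: (values (fun X => X * _ = _ * X)) => [p|p|]; last by rewrite mul0r mulr0.
  apply: (values (fun X => _ * X = X * _)) => [q|q|] //; last by rewrite mul0r mulr0.
  by rewrite mulrN mulNr gC.
apply: (values (fun X => _ * X = X * _)) => [q|q|]; last by rewrite mul0r mulr0.
  by rewrite mulrN mulNr gC.
by rewrite !mulrNN gC.
Qed.

Lemma comm_al_be i j k l :
  [' al i j, be k l] = (d i k * d j l - d i l * d j k)%:A.
Proof.
case: cc => cab _ _.
have base (u v w x : 'I_r) : (u < v)%N -> (w < x)%N ->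
    [' al u v, be w x] = (d u w * d v x - d u x * d v w)%:A.
  move=> uv wx; have [p [ep /(_ a) [-> _]]] := antisym_lt uv.
  have [q [eq /(_ ab) [-> _]]] := antisym_lt wx.
  rewrite cab -val_eqE ep eq /eq_op /=.
  have -> : d u x * d v w = 0.
    have [eux|_] := eqVneq u x; last by rewrite mul0r.
    have [evw|_] := eqVneq v w; last by rewrite mulr0.
    by move: wx; rewrite -eux -evw ltnNge ltnW.
  by rewrite subr0 -natrM mulnb scaler_nat.
have half (u v w x : 'I_r) : (u < v)%N ->
    [' al u v, be w x] = (d u w * d v x - d u x * d v w)%:A.
  move=> uv; have [wx|xw|/val_inj ->] := ltngtP w x; first exact: base.
    by rewrite (antisymN ab) commNr base // -scaleNr opprB.
  by rewrite antisym_diag mulr0 mul0r subrr mulrC subrr scale0r.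
have [ij|ji|/val_inj ->] := ltngtP i j; first exact: half.
  rewrite (antisymN a) commC commNr -commC half // -scaleNr opprB.
  by congr (_%:A); ring.
by rewrite antisym_diag mulr0 mul0r subrr mulrC subrr scale0r.
Qed.

(** The entry (i, j) of Abar A; these operators span gl_r. *)
Definition number_op i j : E := \sum_m be i m * al j m.
Local Notation K_ := number_op.

(** The normally ordered form of the entry (i, j') of Abar A Abar, which differs
from it by a multiple of abar_{i,j'}. *)
Definition quad_op i j : E := \sum_m be m j * K_ i m.

Local Notation Q_ := quad_op.

Let beC i j k l : be i j * be k l = be k l * be i j.
Proof. by case: cc => _ _ h; exact: antisym_commute. Qed.
Let alC i j k l : al i j * al k l = al k l * al i j.
Proof. by case: cc => _ h _; exact: antisym_commute. Qed.

Lemma comm_be_al i j k l :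
  [' be i j, al k l] = (d i l * d j k - d i k * d j l)%:A.
Proof.
rewrite commC comm_al_be -scaleNr; congr (_%:A).
by rewrite ![(k == _)]eq_sym ![(l == _)]eq_sym; ring.
Qed.

Lemma comm_K_be i j k l :
  [' K_ i j, be k l] = d j k *: be i l - d j l *: be i k.
Proof.
rewrite commC comm_sumr.
transitivity (- \sum_m (d k m *: (d j l *: be i m) - d l m *: (d j k *: be i m))).
  congr (- _); apply: eq_bigr => m _.
  rewrite commMr beC subrr mul0r add0r comm_be_al -scalerAr mulr1.
  by rewrite scalerBl !scalerA (eq_sym k j) (eq_sym l j) [d j k * _]mulrC.
by rewrite sumrB !sum_delta opprB.
Qed.

Lemma comm_K_al i j k l :
  [' K_ i j, al k l] = d i l *: al j k - d i k *: al j l.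
Proof.
rewrite commC comm_sumr.
transitivity (- \sum_m (d l m *: (d i k *: al j m) - d k m *: (d i l *: al j m))).
  congr (- _); apply: eq_bigr => m _.
  rewrite commMr (alC k) subrr mulr0 addr0 comm_al_be -scalerAl mul1r.
  by rewrite scalerBl !scalerA (eq_sym k i) (eq_sym l i) mulrC.
by rewrite sumrB !sum_delta opprB.
Qed.

Lemma comm_K_K i j k l :
  [' K_ i j, K_ k l] = d j k *: K_ i l - d i l *: K_ k j.
Proof.
rewrite {2 4}/K_ comm_sumr.
transitivity (\sum_m (d j k *: (be i m * al l m) + d i m *: (be k m * al j l))
  - \sum_m (d j m *: (be i k * al l m) + d i l *: (be k m * al j m))).
  rewrite -sumrB; apply: eq_bigr => m _.
  rewrite commMr comm_K_be comm_K_al mulrBl mulrBr -!scalerAl -!scalerAr.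
  by rewrite opprD addrACA.
rewrite !big_split /= !sum_delta -!scaler_sumr (antisymN ab k i) (antisymN a j l).
by rewrite mulrNN opprD addrA addrK.
Qed.

Lemma Q_antisym i j : Q_ i j = - Q_ j i.
Proof.
transitivity (\sum_m \sum_n be m j * be i n * al m n).
  by apply: eq_bigr => m _; rewrite mulr_sumr; apply: eq_bigr => n _; rewrite mulrA.
rewrite exchange_big -sumrN; apply: eq_bigr => n _ /=.
rewrite mulr_sumr -sumrN; apply: eq_bigr => m _.
by rewrite (antisymN a m) mulrN beC (antisymN ab m) (antisymN ab i) mulrNN mulrA.
Qed.

Let be_K i k : \sum_m be i m * K_ k m = Q_ i k.
Proof.
rewrite Q_antisym -sumrN; apply: eq_bigr => m _.
by rewrite (antisymN ab i) mulNr.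
Qed.

Lemma comm_K_Q i j k l :
  [' K_ i j, Q_ k l] = d j k *: Q_ i l - d j l *: Q_ i k.
Proof.
rewrite {1 2}/Q_ comm_sumr.
transitivity (\sum_m (d j m *: (be i l * K_ k m) + d j k *: (be m l * K_ i m))
   - \sum_m (d i m *: (be m l * K_ k j) + d j l *: (be i m * K_ k m))).
  rewrite -sumrB; apply: eq_bigr => m _.
  rewrite commMr comm_K_be comm_K_K mulrBl mulrBr -!scalerAl -!scalerAr.
  by rewrite opprD (addrC (- _) (- _)) addrACA.
rewrite !big_split /= !sum_delta -!scaler_sumr be_K.
by rewrite [X in X - _]addrC addrKA.
Qed.

(** The quadratic expression on the right is symmetric under exchanging (i, j)
and (k, l), so that the terms linear in t cancel in the bracket of two
[raise_op], see [comm_G_G]. *)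
Lemma comm_Q_be i j k l :
  [' Q_ i j, be k l] = be k j * be i l - be l j * be i k.
Proof.
rewrite commC comm_sumr.
transitivity (- \sum_m (d l m *: (be m j * be i k) - d k m *: (be m j * be i l))).
  congr (- _); apply: eq_bigr => m _.
  rewrite commMr beC subrr mul0r add0r commC comm_K_be opprB mulrBr -!scalerAr.
  by rewrite (eq_sym m k) (eq_sym m l).
by rewrite sumrB !sum_delta opprB.
Qed.

Lemma comm_Q_Q i j k l : [' Q_ i j, Q_ k l] = 0.
Proof.
rewrite commC {2 4}/Q_ comm_sumr.
transitivity (- \sum_m ((be m l * be k j - be j l * be k m) * K_ i m
    + (d l m *: (be m j * Q_ i k) - d k m *: (be m j * Q_ i l)))).
  congr (- _); apply: eq_bigr => m _.
  rewrite commMr comm_Q_be; congr (_ + _).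
  by rewrite commC comm_K_Q opprB mulrBr -!scalerAr (eq_sym m k) (eq_sym m l).
rewrite big_split sumrB /= !sum_delta.
under eq_bigr do rewrite mulrBl (beC _ l) -!mulrA.
rewrite sumrB -!mulr_sumr be_K (antisymN ab j) (Q_antisym k) mulrNN.
by rewrite addrA subrK subrr oppr0.
Qed.

Lemma comm_al_Q i j k l : [' al i j, Q_ k l] =
  d j l *: K_ k i - d i l *: K_ k j + d i k *: K_ l j - d j k *: K_ l i.
Proof.
rewrite {1 2}/Q_ comm_sumr.
transitivity (\sum_m (d i m *: (d j l *: K_ k m) - d j m *: (d i l *: K_ k m)
   + (d i k *: (be l m * al j m) - d j k *: (be l m * al i m)))).
  apply: eq_bigr => m _; rewrite commMr comm_al_be commC comm_K_al.
  rewrite -scalerAl mul1r opprB mulrBr -!scalerAr (eq_sym k i) (eq_sym k j).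
  rewrite scalerBl !scalerA [d i l * _]mulrC (antisymN ab m).
  by rewrite (antisymN a m i) (antisymN a m j) !mulrNN.
by rewrite big_split !sumrB /= !sum_delta -!scaler_sumr !addrA.
Qed.

Variables t x : K.

(** The entry (i, j') of the Lax matrix; ordering it normally cancels the
constant r - 1 in 2 t + r - 1 (see [Lax_ur]). *)
Definition raise_op i j : E := Q_ i j - (2 * t) *: be i j.

Local Notation G_ := raise_op.

Lemma G_antisym i j : G_ i j = - G_ j i.
Proof. by rewrite /G_ Q_antisym (antisymN ab i) scalerN opprB opprK addrC. Qed.

Lemma comm_K_G i j k l :
  [' K_ i j, G_ k l] = d j k *: G_ i l - d j l *: G_ i k.
Proof.
rewrite /G_ commDr commNr commZr comm_K_Q comm_K_be.
rewrite !scalerBr !scalerA ![_ * d _ _]mulrC.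
by rewrite opprD addrACA -opprD.
Qed.

Lemma comm_G_G i j k l : [' G_ i j, G_ k l] = 0.
Proof.
have e1 : [' G_ i j, Q_ k l] = (2 * t) *: [' Q_ k l, be i j].
  by rewrite commC commDr commNr commZr comm_Q_Q sub0r opprK.
have e2 : [' G_ i j, be k l] = [' Q_ i j, be k l].
  by rewrite commC commDr commNr commZr beC subrr scaler0 subr0 -commC.
rewrite {2 4}/G_ commDr commNr commZr e1 e2 !comm_Q_be -scalerBr.
by rewrite (antisymN ab j) (antisymN ab k i) mulrNN (beC i l) subrr scaler0.
Qed.

Lemma comm_al_G i j k l : [' al i j, G_ k l] =
  d j l *: K_ k i - d i l *: K_ k j + d i k *: K_ l j - d j k *: K_ l i
  - ((2 * t) * (d i k * d j l - d i l * d j k))%:A.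
Proof. by rewrite /G_ commDr commNr commZr comm_al_Q comm_al_be scalerA. Qed.

Lemma Lax_ul i k : Lax t x a ab (lshift r i) (lshift r k) =
  ((x + t) * d i k)%:A - K_ i k.
Proof.
rewrite block_mxEul !mxE; congr (_ - _); last first.
  rewrite (reindex_inj rev_ord_inj); apply: eq_bigr => m _.
  by rewrite !mxE rev_ordK.
by case: eqP; rewrite ?mulr1 ?mulr0 ?scale0r.
Qed.

Lemma Lax_dl j i : Lax t x a ab (primed j) (lshift r i) = al j i.
Proof. by rewrite primedE block_mxEdl !mxE rev_ordK (antisymN a j). Qed.

Let sum_al_be j l :
  \sum_i al i j * be i l = K_ l j + ((r%:R - 1) * d j l)%:A.
Proof.
have -> : K_ l j = \sum_i be i l * al i j.
  by apply: eq_bigr => i _; rewrite (antisymN ab i) (antisymN a i) mulrNN.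
have -> : ((r%:R - 1) * d j l)%:A = \sum_i [' al i j, be i l].
  under eq_bigr do rewrite comm_al_be eqxx mul1r scalerBl -scalerA.
  rewrite sumrB sumr_const card_ord (eq_bigr (fun i => d l i *: (d j i)%:A)).
    by rewrite sum_delta -scaler_nat scalerA -scalerBl mulrBl mul1r.
  by move=> i _; rewrite eq_sym.
by rewrite -big_split; apply: eq_bigr => i _ /=; rewrite addrC subrK.
Qed.

Let mulrb_alg c (b : bool) : c%:A *+ b = (c * b%:R)%:A :> E.
Proof. by case: b; rewrite ?mulr1 ?mulr0 ?scale0r. Qed.

Lemma Lax_dr j l : Lax t x a ab (primed j) (primed l) =
  ((x - t) * d j l)%:A + K_ l j.
Proof.
rewrite !primedE block_mxEdr !mxE (inj_eq rev_ord_inj).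
under eq_bigr do rewrite !mxE !rev_ordK.
rewrite sum_al_be addrCA addrC; congr (_ + _).
by rewrite mulrb_alg -scalerDl; congr (_%:A); ring.
Qed.

Lemma Lax_ur i j : Lax t x a ab (lshift r i) (primed j) = G_ i j.
Proof.
rewrite primedE block_mxEur !mxE (reindex_inj rev_ord_inj) /=.
transitivity (- \sum_m (d j m *: ((2 * t) *: be i m) - be i m * K_ j m)).
  congr (- _); apply: eq_bigr => m _.
  rewrite !mxE rev_ordK (inj_eq rev_ord_inj) (eq_sym j m).
  rewrite (eq_bigr (fun k => al k m * be k j)) => [|k _].
    rewrite sum_al_be opprD addrCA mulrDr mulrN [LHS]addrC; congr (_ - _).
    rewrite mulrb_alg -scalerBl -scalerAr mulr1 scalerA; congr (_ *: _); ring.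
  by rewrite !mxE !rev_ordK.
by rewrite sumrB sum_delta be_K opprB.
Qed.

(** At x = 0 the Lax matrix is skew with respect to the antidiagonal, that is,
it takes values in so_2r; the shift x breaks this but not the brackets. *)
Lemma Lax_antisym (p q : 'I_(r + r)) : x = 0 ->
  Lax t x a ab p q = - Lax t x a ab (rev_ord q) (rev_ord p).
Proof.
move=> x0.
case: (labelP p) => ->; case: (labelP q) => ->; rewrite ?rev_ordK -!/(primed _).
- by rewrite Lax_ul Lax_dr x0 sub0r add0r mulNr scaleNr opprD opprK eq_sym.
- by rewrite !Lax_ur G_antisym.
- by rewrite !Lax_dl (antisymN a).
- by rewrite Lax_ul Lax_dr x0 sub0r add0r mulNr scaleNr opprB addrC eq_sym.
Qed.

Lemma Lax0_brackets (p q : 'I_(r + r) * 'I_(r + r)) (X := fun u => Lax t x a ab u.1 u.2) :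
  x = 0 ->
  X p * X q - X q * X p = \sum_(u <- so_bracket K p q) u.1 *: X u.2.
Proof.
move=> x0.
have Xa u v : X (u, v) = - X (rev_ord v, rev_ord u) by exact: Lax_antisym.
have ll (i j : 'I_r) : (lshift r i == lshift r j) = (i == j).
  by rewrite (inj_eq (@lshift_inj _ _)).
have pp (i j : 'I_r) : (primed i == primed j) = (i == j).
  by rewrite (inj_eq rev_ord_inj).
have lp (i j : 'I_r) : (lshift r i == primed j) = false.
  by rewrite primedE eq_lrshift.
have pl (i j : 'I_r) : (primed j == lshift r i) = false.
  by rewrite primedE eq_rlshift.
have rp (i : 'I_r) : rev_ord (primed i) = lshift r i by rewrite rev_ordK.
have rl (i : 'I_r) : rev_ord (lshift r i) = primed i by [].
have e00 (Y : E) : (- (false%:R : K)) *: Y = 0 by rewrite oppr0 scale0r.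
have e0 (Y : E) : (false%:R : K) *: Y = 0 by rewrite scale0r.
pose rel p q :=
  X p * X q - X q * X p = \sum_(u <- so_bracket K p q) u.1 *: X u.2.
have relE p1 p2 q1 q2 : rel (p1, p2) (q1, q2) <->
    [' X (p1, p2), X (q1, q2)] = (p1 == q2)%:R *: X (q1, p2) - (p2 == q1)%:R *: X (p1, q2)
     + (p2 == rev_ord q2)%:R *: X (p1, rev_ord q1) - (p1 == rev_ord q1)%:R *: X (rev_ord q2, p2).
  rewrite /rel !(big_cons, big_nil) /= addr0 !scaleNr addrA (addrC (- _)) addrA.
  by [].
have XE := (Lax_ul, Lax_dl, Lax_dr, Lax_ur).
have simp := (rl, rp, ll, pp, lp, pl, e0, e00, subr0, addr0, sub0r).
have kk i j k l : rel (lshift r i, lshift r j) (lshift r k, lshift r l).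
  apply/relE; rewrite !simp /X /= !XE comm_algl comm_algr opprK comm_K_K.
  rewrite !scalerBr !scalerA (eq_sym k j) mulrCA (mulrCA (d j k)) (mulrC (d i l)).
  by rewrite opprB [RHS]addrC subrKA.
have kg i j k l : rel (lshift r i, lshift r j) (lshift r k, primed l).
  apply/relE; rewrite !simp /X /= !XE comm_algl comm_K_G.
  by rewrite opprD opprK.
have ka i j k l : rel (lshift r i, lshift r j) (primed k, lshift r l).
  apply/relE; rewrite !simp /X /= !XE comm_algl comm_K_al.
  by rewrite (antisymN a j k) (antisymN a j l) !scalerN opprD !opprK.
have gg i j k l : rel (lshift r i, primed j) (lshift r k, primed l).
  by apply/relE; rewrite !simp /X /= !XE comm_G_G oppr0.
have aa i j k l : rel (primed i, lshift r j) (primed k, lshift r l).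
  by apply/relE; rewrite !simp /X /= !XE alC subrr oppr0.
have ag i j k l : rel (primed i, lshift r j) (lshift r k, primed l).
  apply/relE; rewrite !simp /X /= !XE comm_al_G x0 !add0r.
  have -> : (2 * t * (d i k * d j l - d i l * d j k))%:A =
      d j k *: (- t * d i l)%:A - d j l *: (- t * d i k)%:A
      + d i k *: (t * d l j)%:A - d i l *: (t * d k j)%:A :> E.
    rewrite !scalerA -!scalerBl -scalerDl -scalerBl; congr (_%:A).
    by rewrite (eq_sym l) (eq_sym k); ring.
  rewrite !scalerDr !opprD !opprK !scalerN !opprK !addrA.
  (* operator terms first, then the four scalar ones *)
  by rewrite [RHS](ACl (6*2*8*4*3*5*7*1)).
have sym p1 q1 : rel p1 q1 -> rel q1 p1 by exact: bracket_sym.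
have rev p1 p2 q1 : rel (p1, p2) q1 -> rel (rev_ord p2, rev_ord p1) q1.
  exact: bracket_rev.
have red q1 : (forall i j, rel (lshift r i, lshift r j) q1) ->
    (forall i j, rel (lshift r i, primed j) q1) ->
    (forall i j, rel (primed i, lshift r j) q1) -> forall p1, rel p1 q1.
  move=> rk rg ra [p1 p2].
  case: (labelP p1) => ->; case: (labelP p2) => ->; rewrite ?label_lshift ?label_primed //.
  exact/rev/rk.
have fk k l p1 : rel p1 (lshift r k, lshift r l).
  by apply: red => // i j; apply: sym.
have fg k l p1 : rel p1 (lshift r k, primed l).
  by apply: red.
have fa k l p1 : rel p1 (primed k, lshift r l).
  by apply: red => // i j; apply: sym.
by apply/sym/red => i j; apply: sym.
Qed.

End Orthogonal.

(** * The Lax matrices with reflected oscillators *)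

Section LaxBrackets.
Variables (K : fieldType) (E : algType K) (r : nat).
Variables a ab : osc r -> E.
Hypothesis cc : ccr a ab.

(** The scalar matrix x is invariant, so it contributes nothing to either side
and the relations at x = 0 extend to all x. *)
Lemma Lax_brackets t x :
  brackets (@so_bracket K r) (fun u => Lax t x a ab u.1 u.2).
Proof.
move=> p q.
pose L u := Lax t 0 a ab u.1 u.2.
have LaxD u : Lax t x a ab u.1 u.2 = ((u.1 == u.2)%:R * x)%:A - - L u.
  rewrite opprK Lax0E [LHS]mxE [X in X + _]mxE.
  by case: eqP => _; rewrite ?mul1r ?mul0r ?scale0r.
rewrite !LaxD comm_algl comm_algr opprK mulrNN mulrNN (Lax0_brackets cc) //.
under [RHS]eq_bigr do rewrite LaxD scalerBr scalerN opprK.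
rewrite big_split /= -[LHS]add0r; congr (_ + _).
case: p q => [p1 p2] [q1 q2]; rewrite !(big_cons, big_nil) /= addr0 !scalerA -!scalerDl.
rewrite -[LHS](scale0r 1); congr (_%:A).
by rewrite (eq_sym q1) (eq_sym (rev_ord q2)); ring.
Qed.

End LaxBrackets.

Section FlippedLabels.
Variables (r : nat).
Implicit Types (mu : signs r) (p q : 'I_(r + r)).

(** Conjugation by B_mu permutes the labels in this way. *)
Definition flip_index mu p := if mu (label p) then rev_ord p else p.

Lemma flip_index_rev mu p : flip_index mu (rev_ord p) = rev_ord (flip_index mu p).
Proof. by rewrite /flip_index label_rev; case: ifP. Qed.

Lemma flip_indexK mu : involutive (flip_index mu).
Proof.
move=> p; rewrite {2}/flip_index; case: ifP => mp; last by rewrite /flip_index mp.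
by rewrite flip_index_rev /flip_index mp rev_ordK.
Qed.

Section LaxSign.
Variables (K : fieldType) (E : algType K) (mu : signs r).

Lemma B_sign_perm : exists s : 'S_(r + r),
  B_sign K mu = perm_mx s /\ s =1 flip_index mu.
Proof.
suff H (e : seq 'I_r) : uniq e -> exists s : 'S_(r + r),
    \prod_(j <- e | mu j) B_mx K j = perm_mx s /\
    s =1 (fun p => if (label p \in e) && mu (label p) then rev_ord p else p).
  have [s [e1 e2]] := H _ (index_enum_uniq 'I_r); exists s; split; first exact: e1.
  by move=> p; rewrite e2 mem_index_enum.
elim: e => [|j e IHe] /=.
  by exists 1%g; rewrite big_nil perm_mx1; split=> // p; rewrite perm1.
move=> /andP[je /IHe [s [es sE]]]; rewrite big_cons.
case mj: (mu j); last first.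
  exists s; split=> // p; rewrite sE inE.
  by case: eqP => [->|//]; rewrite mj !andbF.
exists (tperm (lshift r j) (primed j) * s)%g; split.
  by rewrite perm_mxM es B_mxE.
move=> p; rewrite permM sE inE.
have [ep|np] := eqVneq (label p) j.
  rewrite ep mj /=; case: (labelP p) => ->; rewrite ep.
    by rewrite tpermL label_primed (negPf je).
  by rewrite tpermR label_lshift (negPf je) rev_ordK.
suff -> : tperm (lshift r j) (primed j) p = p by [].
apply: tpermD; apply: contraNneq np => <-.
  by rewrite label_lshift.
by rewrite label_primed.
Qed.

Lemma Lax_sign_entry t x (a ab : osc r -> E) p q :
  Lax_sign mu t x a ab p q =
  Lax t x (flip_a mu a ab) (flip_abar mu a ab) (flip_index mu p) (flip_index mu q).
Proof.
have [s [Bs sE]] := B_sign_perm.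
have invs : invmx (perm_mx s) = perm_mx s^-1 :> 'M[K]_(r + r).
  by rewrite -[LHS]mulmx1 -perm_mx1 -(mulgV s) perm_mxM mulKmx ?unitmx_perm.
by rewrite /Lax_sign Bs invs !map_perm_mx -row_permE -col_permE 2!mxE !sE.
Qed.

(** The reflected oscillators are again canonical, and [flip_index] commutes
with i |-> i', which are the only data that enter the relations. *)
Lemma Lax_sign_brackets t x (a ab : osc r -> E) : ccr a ab ->
  brackets (@so_bracket K r) (fun u => Lax_sign mu t x a ab u.1 u.2).
Proof.
move=> cc [p1 p2] [q1 q2]; rewrite !Lax_sign_entry.
pose g p := flip_index mu p; have gI : injective g := can_inj (flip_indexK mu).
have := Lax_brackets (flip_ccr mu cc) t x (g p1, g p2) (g q1, g q2) => /= ->.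
rewrite !(big_cons, big_nil) /= !Lax_sign_entry -/(g _).
rewrite -!(flip_index_rev mu) -!/(g _) !(inj_eq gI).
by [].
Qed.

End LaxSign.
End FlippedLabels.

Section Diagonal.
Variables (K : fieldType) (E : algType K) (r : nat).
Variables a ab : osc r -> E.
Hypothesis cc : ccr a ab.

Definition opposite (mu : signs r) : signs r := [ffun i => ~~ mu i].

Lemma oppositeK : involutive opposite.
Proof. by move=> mu; apply/ffunP => i; rewrite !ffunE negbK. Qed.

Definition reflected_spin (t : K) : K := - r%:R + 1 - t.

(** Reversing all signs exchanges a and abar up to a sign, which turns normally
ordered products into antinormally ordered ones. The commutators of the r - 1
oscillators that involve i produce the constant. *)
Lemma number_op_opposite (mu : signs r) i :
  number_op (flip_a (opposite mu) a ab) (flip_abar (opposite mu) a ab) i i =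
  - number_op (flip_a mu a ab) (flip_abar mu a ab) i i - (r%:R - 1)%:A.
Proof.
set a1 := flip_a mu _ _; set ab1 := flip_abar mu _ _.
rewrite /number_op.
transitivity (\sum_m - (antisym a1 i m * antisym ab1 i m)).
  apply: eq_bigr => m _.
  have flip p : flip_abar (opposite mu) a ab p * flip_a (opposite mu) a ab p =
      - (a1 p * ab1 p).
    rewrite /a1 /ab1 /flip_a /flip_abar ffunE; case: (mu _) => /=.
      by rewrite mulrN opprK.
    by rewrite mulNr.
  rewrite /antisym; case: insub => [p|]; first exact: flip.
  case: insub => [p|]; last by rewrite mul0r oppr0.
  by rewrite !mulrNN flip.
rewrite sumrN -opprD; congr (- _).
transitivity (\sum_m (antisym ab1 i m * antisym a1 i m + (1 - (i == m)%:R)%:A)).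
  apply: eq_bigr => m _; apply/eqP; rewrite addrC -subr_eq; apply/eqP.
  rewrite (comm_al_be (flip_ccr mu cc)) !eqxx mul1r; congr (_%:A).
  by rewrite (eq_sym m); case: eqP; rewrite ?mulr1 ?mulr0.
rewrite big_split /=; congr (_ + _).
rewrite -scaler_suml sumrB sumr_const card_ord; congr ((_ - _)%:A).
rewrite (bigD1 i) //= eqxx big1 ?addr0 // => m.
by rewrite eq_sym => /negPf ->.
Qed.

(** Reversing mu exchanges the two diagonal blocks, with diagonal entries
x + t - N and x - t + N for N = number_op; the constant r - 1 of
[number_op_opposite] is what the shift of the spin absorbs. *)
Lemma Lax_sign_diag_opposite mu t x p :
  Lax_sign mu t x a ab p p = Lax_sign (opposite mu) (reflected_spin t) x a ab p p.
Proof.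
have half (nu : signs r) (i : 'I_r) (u : K) : nu i = false -> let q := lshift r i in
    Lax_sign nu u x a ab q q = Lax_sign (opposite nu) (reflected_spin u) x a ab q q.
  move=> ni q; rewrite !Lax_sign_entry /flip_index /q label_lshift ffunE ni /=.
  rewrite Lax_ul -[rev_ord _]/(primed i) (Lax_dr (flip_ccr _ cc)).
  rewrite number_op_opposite addrCA [LHS]addrC -scalerBl; congr (_ + _%:A).
  by rewrite eqxx !mulr1 /reflected_spin; ring.
have half' (nu : signs r) (i : 'I_r) (u : K) : nu i = true -> let q := primed i in
    Lax_sign nu u x a ab q q = Lax_sign (opposite nu) (reflected_spin u) x a ab q q.
  move=> ni q; rewrite !Lax_sign_entry /flip_index /q label_primed ffunE ni /=.
  rewrite rev_ordK Lax_ul (Lax_dr (flip_ccr _ cc)).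
  rewrite number_op_opposite addrCA [LHS]addrC -scalerBl; congr (_ + _%:A).
  by rewrite eqxx !mulr1 /reflected_spin; ring.
have spinK : reflected_spin (reflected_spin t) = t by rewrite /reflected_spin; ring.
set i := label p; case ni: (mu i); case: (labelP p) => ->; rewrite -/i.
- rewrite -{1}(oppositeK mu) -{1}spinK; apply/esym/half.
  by rewrite ffunE ni.
- exact: half'.
- exact: half.
- rewrite -{1}(oppositeK mu) -{1}spinK; apply/esym/half'.
  by rewrite ffunE ni.
Qed.

End Diagonal.

Section LaxTwists.
Variables (K : fieldType) (E : algType K) (r : nat).
Variables (A : E -> Prop) (f : E -> K).
Hypothesis lin : linear_on A f.
Variables (a ab : osc r -> E) (u : 'I_r -> K).
Hypothesis cc : ccr a ab.
Hypothesis u_neq0 : forall i, u i != 0.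
Hypothesis ta : forall i j, twists A f (u i * u j) (antisym a i j).
Hypothesis tab : forall i j, twists A f (u i * u j)^-1 (antisym ab i j).

(** The weights eps_i and - eps_i of the vector representation, evaluated at u. *)
Definition weight (p : 'I_(r + r)) : K :=
  if split p is inl i then u i else (u (label p))^-1.

Lemma weight_lshift i : weight (lshift r i) = u i.
Proof. by rewrite /weight -[lshift r i]/(unsplit (inl i)) unsplitK. Qed.

Lemma weight_primed i : weight (primed i) = (u i)^-1.
Proof.
rewrite /weight label_primed; case: (split_ordP (primed i)) => // j.
by rewrite primedE => /eqP; rewrite eq_rlshift.
Qed.

Lemma number_op_twists i j : twists A f (u j / u i) (number_op a ab i j).
Proof.
apply: twists_sum => // m _.
have -> : u j / u i = (u i * u m)^-1 * (u j * u m).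
  by rewrite invfM mulrCA !mulrA mulrVK ?unitfE // mulrC.
exact: twistsM.
Qed.

Lemma Lax_twists t x p q :
  twists A f (weight q / weight p) (Lax t x a ab p q).
Proof.
have scalar c i j : twists A f (u i / u j) ((c * (i == j)%:R)%:A).
  have [->|_] := eqVneq; last by rewrite mulr0 scale0r; exact: twists0.
  by rewrite divff //; apply: twistsZ => //; exact: twists1.
case: (labelP p) => ->; case: (labelP q) => ->; rewrite !(weight_lshift, weight_primed).
- rewrite Lax_ul; apply: twistsD => //; first by rewrite eq_sym.
  by apply: twistsN => //; exact: number_op_twists.
- rewrite (Lax_ur cc) -invfM mulrC; apply: twistsD => //; last first.
    by apply: twistsN => //; apply: twistsZ.
  apply: twists_sum => // m _.
  set i := label p; set j := label q.
  have -> : (u i * u j)^-1 = (u m * u j)^-1 * (u m / u i).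
    by field; rewrite !u_neq0.
  by apply: twistsM => //; exact: number_op_twists.
- by rewrite Lax_dl invrK mulrC.
- rewrite (Lax_dr cc) invrK [X in twists _ _ X _]mulrC; apply: twistsD => //.
  exact: number_op_twists.
Qed.

End LaxTwists.

(** * Unconditional complex sums *)

Lemma ler_sum_subset (R : numDomainType) (I : eqType) (s1 s2 : seq I) (F : I -> R) :
    uniq s1 -> uniq s2 -> {subset s1 <= s2} -> (forall i, 0 <= F i) ->
  \sum_(i <- s1) F i <= \sum_(i <- s2) F i.
Proof.
move=> u1 u2 s12 F0.
rewrite (perm_big [seq i <- s2 | i \in s1]) /=; last first.
  apply: uniq_perm; rewrite ?filter_uniq // => i.
  by rewrite mem_filter; case: (boolP (i \in s1)) => //= /s12.
rewrite big_filter big_mkcond; apply: ler_sum => i _; by case: ifP.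
Qed.

(* limits along the finite subsets of the index type need it *)
#[local] Existing Instance summability.totally_filter.

Section Sums.
Local Open Scope classical_set_scope.
Variables (C : numFieldType) (I : choiceType).
Implicit Types (g h : I -> C) (l : C).

Definition sums_to g l : Prop :=
  summability.partial_sum (g : I -> C^o) @ summability.totally --> (l : C^o).

Lemma partial_sumE (V : zmodType) (g : I -> V) (A : {fset I}) :
  summability.partial_sum g A = \sum_(i <- A) g i.
Proof. by rewrite /summability.partial_sum [RHS]big_seq_fsetE. Qed.

Lemma sums_to_sum g l : sums_to g l -> summability.sum (g : I -> C^o) = l.
Proof. by move=> gl; apply: cvg_lim => //; exact: norm_hausdorff. Qed.

Lemma sums_toD g h l m : sums_to g l -> sums_to h m ->
  sums_to (fun i => g i + h i) (l + m).
Proof.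
move=> gl hm; rewrite /sums_to (_ : summability.partial_sum _ =
  summability.partial_sum (g : I -> C^o) \+ summability.partial_sum (h : I -> C^o)).
  exact: cvgD.
by apply/funext => A; rewrite /= !partial_sumE big_split.
Qed.

Lemma sums_toZ c g l : sums_to g l -> sums_to (fun i => c * g i) (c * l).
Proof.
move=> gl; rewrite /sums_to (_ : summability.partial_sum _ =
  c \*: summability.partial_sum (g : I -> C^o)); first exact: cvgZr.
by apply/funext => A; rewrite /= !partial_sumE scaler_sumr.
Qed.

Lemma sums_toP g l :
  sums_to g l <->
  forall e : C, 0 < e -> exists A : {fset I}, forall B : {fset I}, (A `<=` B)%fset ->
    `|l - \sum_(i <- B) g i| < e.
Proof.
split=> [/cvgrPdist_lt gl e /gl[A _ AB]|gl].
  by exists A => B /AB; rewrite /= partial_sumE.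
apply/cvgrPdist_lt => e /gl[A AB]; exists A => // B /= /AB.
by rewrite partial_sumE.
Qed.

(** Unconditional sums do not see the order of the terms: the finite sets that
contain u(A) pull back along u to finite sets that contain A, up to indices
where g vanishes. *)
Lemma sums_to_reindex (u v : I -> I) (P : pred I) g l :
    cancel u v -> (forall i, P (u i)) -> {in P, cancel v u} ->
    (forall i, ~~ P i -> g i = 0) ->
  sums_to (g \o u) l -> sums_to g l.
Proof.
move=> uK Pu vK g0 /sums_toP gl; apply/sums_toP => e /gl[A AB].
exists (u @` A)%fset => B /fsubsetP uAB.
pose B' := (v @` [fset i in B | P i])%fset.
have -> : \sum_(i <- B) g i = \sum_(i <- B') (g \o u) i.
  rewrite big_imfset /=; last first.
    move=> i j; rewrite !inE /= => /andP[_ Pi] /andP[_ Pj] e'.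
    by rewrite -(vK i Pi) -(vK j Pj) e'.
  rewrite big_fset /= [RHS](eq_bigr g) => [|i Pi]; last by rewrite /= vK.
  rewrite [RHS]big_mkcond; apply: eq_bigr => i _.
  by case: ifPn => // /g0.
apply: AB; apply/fsubsetP => i iA; apply/imfsetP; exists (u i); last by rewrite uK.
by rewrite !inE /= Pu andbT; apply: uAB; apply/imfsetP; exists i.
Qed.

End Sums.

Section ComplexSums.
Local Open Scope classical_set_scope.
Variables (R : realType) (I : choiceType).
Local Notation C := R[i].

Lemma nonneg_sums_to (h : I -> R) (M : R) :
    (forall i, 0 <= h i) -> (forall A : {fset I}, \sum_(i <- A) h i <= M) ->
  exists l : R, sums_to (fun i => (h i)%:C%C : C) (l%:C)%C.
Proof.
move=> h0 hM; pose S := [set s | exists A : {fset I}, s = \sum_(i <- A) h i].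
have S0 : S !=set0 by exists 0, fset0; rewrite big_seq_fset0.
have Sub : has_sup S by split=> //; exists M => _ [A ->].
exists (sup S); apply/sums_toP => e; rewrite ltcE /= => /andP[/eqP e_im e0].
have [s [A ->] sA] := sup_adherent e0 Sub; exists A => B AB.
have le1 : \sum_(i <- B) h i <= sup S by apply: (sup_upper_bound Sub); exists B.
have le2 : \sum_(i <- A) h i <= \sum_(i <- B) h i.
  by apply: ler_sum_subset => //; exact/fsubsetP.
rewrite -(raddf_sum (real_complex R)) -raddfB normc_def /= expr0n addr0 sqrtr_sqr.
rewrite ltcE /= e_im eqxx /= ger0_norm ?subr_ge0 //.
by rewrite ltrBlDr -ltrBlDl; apply: lt_le_trans le2.
Qed.

Definition abs_bounded (g : I -> C) : Prop :=
  exists M : C, forall A : {fset I}, \sum_(i <- A) `|g i| <= M.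

(** The positive and negative parts of the real and imaginary parts have
bounded nonnegative partial sums, which converge to their supremum. *)
Lemma abs_bounded_sums_to (g : I -> C) :
  abs_bounded g -> exists l, sums_to g l.
Proof.
move=> [M gM].
have part (h : I -> R) : (forall i, `|h i|%:C%C <= `|g i|) ->
    exists l : C, sums_to (fun i => (h i)%:C%C : C) l.
  move=> hg.
  have part0 (k : I -> R) : (forall i, 0 <= k i <= `|h i|) ->
      exists l : R, sums_to (fun i => (k i)%:C%C : C) (l%:C)%C.
    move=> kh; apply: (@nonneg_sums_to _ (complex.Re M)) => [i|A].
      by case/andP: (kh i).
    have : (\sum_(i <- A) k i)%:C%C <= M.
      apply: le_trans (gM A); rewrite raddf_sum; apply: ler_sum => i _ /=.
      by apply: le_trans (hg i); rewrite lecR; case/andP: (kh i).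
    by rewrite lecE => /andP[].
  have [lp hp] : exists l : R, sums_to (fun i => (Num.max (h i) 0)%:C%C : C) (l%:C)%C.
    apply: part0 => i; rewrite le_max lexx orbT /=.
    by rewrite ge_max ler_norm normr_ge0.
  have [ln hn] : exists l : R, sums_to (fun i => (Num.max (- h i) 0)%:C%C : C) (l%:C)%C.
    apply: part0 => i; rewrite le_max lexx orbT /=.
    by rewrite ge_max -normrN ler_norm normr_ge0.
  eexists; have := sums_toD hp (@sums_toZ _ _ (-1) _ _ hn).
  congr sums_to; apply/funext => i; rewrite mulN1r -raddfB /=; congr (_%:C%C).
  have [h0|h0] := leP 0 (h i).
    by rewrite max_r ?subr0 // oppr_le0.
  by rewrite max_l ?opprK ?add0r // oppr_ge0 ltW.
have [lr hr] : exists l : C, sums_to (fun i => (complex.Re (g i))%:C%C : C) l.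
  by apply: part => i; exact: normc_ge_Re.
have [li hi] : exists l : C, sums_to (fun i => (complex.Im (g i))%:C%C : C) l.
  apply: part => i; rewrite -[complex.Im _]opprK -ReiNIm normrN.
  apply: le_trans (normc_ge_Re _) _; rewrite normrM.
  by rewrite (normc_def 'i%C) /= expr0n expr1n add0r sqrtr1 mulr1.
exists (lr + 'i%C * li); have := sums_toD hr (@sums_toZ _ _ 'i%C _ _ hi).
by congr sums_to; apply/funext => i; rewrite -complexE.
Qed.

End ComplexSums.

(** * Summability of polynomially growing families against geometric ones *)

Section GeometricBounds.
Variable R : realType.
Implicit Types q s : R.

Lemma sum_geometric_le s n : 0 <= s < 1 -> \sum_(j < n) s ^+ j <= (1 - s)^-1.
Proof.
case/andP=> s0 s1; have s1' : 0 < 1 - s by rewrite subr_gt0.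
rewrite -[leRHS]mul1r ler_pdivlMr //.
have -> : (\sum_(j < n) s ^+ j) * (1 - s) = 1 - s ^+ n.
  rewrite mulrC -(opprB s 1) mulNr -subrX1 opprB //.
by rewrite gerBl exprn_ge0.
Qed.

(** Splitting q = s^2 gives n^(k + 1) q^n = (n^k s^n) (n s^n) with n + 1 for n;
the last factor is at most a geometric sum since the powers of s decrease. *)
Lemma poly_geometric_bounded k q : 0 <= q < 1 ->
  exists B, forall n, n.+1%:R ^+ k * q ^+ n <= B.
Proof.
elim: k q => [|k IHk] q /[dup] q01 /andP[q0 q1].
  by exists 1 => n; rewrite expr0 mul1r exprn_ile1 // ltW.
set s := Num.sqrt q; have s0 : 0 <= s by exact: sqrtr_ge0.
have ss : s * s = q by rewrite -expr2 sqr_sqrtr.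
have s1 : s < 1 by rewrite -sqrtr1 ltr_sqrt.
have s01 : 0 <= s < 1 by rewrite s0.
have [B kB] := IHk s s01; exists (B / (1 - s)) => n.
rewrite exprSr -ss exprMn mulrACA; apply: ler_pM => //.
- by rewrite mulr_ge0 // exprn_ge0.
- by rewrite mulr_ge0 // exprn_ge0.
apply: le_trans (sum_geometric_le n.+1 s01).
rewrite mulr_natl -[X in _ *+ X](card_ord n.+1) -sumr_const.
apply: ler_sum => i _; rewrite ler_wiXn2l // ?ltW //.
by rewrite -ltnS.
Qed.

(** A finite set of monomials lies in a box, on which the sum factors into
geometric sums. *)
Lemma sum_multinom_le d s (A : seq (multinom d)) : 0 <= s < 1 -> uniq A ->
  \sum_(m <- A) s ^+ mdeg m <= (1 - s)^-1 ^+ d.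
Proof.
move=> s01 uA; have /andP[s0 s1] := s01.
pose n := \max_(m <- A) mdeg m.
pose mu (g : {ffun 'I_d -> 'I_n.+1}) : (multinom d) := Multinom [tuple (g i : nat) | i < d].
have muI : injective mu.
  move=> g h e; apply/ffunP => i; apply/val_inj.
  by have /(congr1 (fun m : (multinom d) => m i)) := e; rewrite !mnmE.
apply: (@le_trans _ _ (\sum_(m <- [seq mu g | g in {ffun 'I_d -> 'I_n.+1}]) s ^+ mdeg m)).
  apply: ler_sum_subset => //.
  - by rewrite map_inj_uniq ?enum_uniq.
  - move=> m mA; have mi i : (m i < n.+1)%N.
      rewrite ltnS; apply: (@leq_trans (mdeg m)).
        by rewrite mdegE (bigD1 i) //= leq_addr.
      exact: leq_bigmax_seq.
    apply/mapP; exists [ffun i => Ordinal (mi i)]; first by rewrite mem_enum.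
    by apply/mnmP => i; rewrite mnmE ffunE.
  - by move=> m; exact: exprn_ge0.
rewrite big_image /=.
under eq_bigr do rewrite mdegE expr_sum.
rewrite (eq_bigr (fun g : {ffun 'I_d -> 'I_n.+1} => \prod_i s ^+ g i)); last first.
  by move=> g _; apply: eq_bigr => i _; rewrite mnmE.
rewrite -(bigA_distr_bigA (fun (i : 'I_d) (j : 'I_n.+1) => s ^+ j)) /=.
rewrite prodr_const card_ord; apply: lerXn2r.
- by rewrite nnegrE sumr_ge0 // => i _; exact: exprn_ge0.
- by rewrite nnegrE invr_ge0 subr_ge0 ltW.
exact: sum_geometric_le.
Qed.

End GeometricBounds.

(** * Traces over the Fock module *)

(* these names also belong to the theory of vector spaces *)
Local Notation coord := Defs.coord.
Local Notation basis := Defs.basis.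

Section Tame.
Variables (R : realType) (r : nat).
Local Notation C := R[i].
Local Notation V := (Fock R r).
Local Notation state := (state r).
Implicit Types (m n : state) (v : V) (W X : endo V).

(** The l1 norm is bounded through all finite partial sums rather than over the
support of v, which would change under addition. *)
Definition deg_l1_le v (h : nat) (M : C) : Prop :=
  (forall n, (h < mdeg n)%N -> coord n v = 0) /\
  (forall s : seq state, uniq s -> \sum_(n <- s) `|coord n v| <= M).

Lemma coordD n v1 v2 : coord n (v1 + v2) = coord n v1 + coord n v2.
Proof. by rewrite /coord mcoeffD. Qed.

Lemma coordZ n c v : coord n (c *: v) = c * coord n v.
Proof. by rewrite /coord mcoeffZ. Qed.

Lemma deg_l1_le_coord v h M n : deg_l1_le v h M -> `|coord n v| <= M.
Proof. by case=> _ /(_ [:: n] isT); rewrite big_seq1. Qed.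

Lemma deg_l1_le_weaken v h M h' M' : deg_l1_le v h M -> (h <= h')%N -> M <= M' ->
  deg_l1_le v h' M'.
Proof.
move=> [vh vM] hh MM; split=> [n nh|s us]; first by rewrite vh // (leq_ltn_trans hh).
exact: le_trans (vM s us) MM.
Qed.

Lemma deg_l1_le0 h : deg_l1_le 0 h 0.
Proof.
split=> [n _|s _]; first by rewrite /coord mcoeff0.
by rewrite big1 // => n _; rewrite /coord mcoeff0 normr0.
Qed.

Lemma deg_l1_leD v1 v2 h M1 M2 :
  deg_l1_le v1 h M1 -> deg_l1_le v2 h M2 -> deg_l1_le (v1 + v2) h (M1 + M2).
Proof.
move=> [v1h v1M] [v2h v2M]; split=> [n nh|s us].
  by rewrite coordD v1h // v2h // addr0.
apply: le_trans (lerD (v1M s us) (v2M s us)); rewrite -big_split.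
by apply: ler_sum => n _; rewrite coordD ler_normD.
Qed.

Lemma deg_l1_leZ c v h M : deg_l1_le v h M -> deg_l1_le (c *: v) h (`|c| * M).
Proof.
move=> [vh vM]; split=> [n nh|s us]; first by rewrite coordZ vh // mulr0.
apply: le_trans (ler_wpM2l (normr_ge0 c) (vM s us)); rewrite mulr_sumr.
by apply: ler_sum => n _; rewrite coordZ normrM.
Qed.

Lemma deg_l1_le_basis m : deg_l1_le (basis R m) (mdeg m) 1.
Proof.
split=> [n nm|s us]; rewrite /coord.
  by rewrite mcoeffX; case: eqP nm => // ->; rewrite ltnn.
have [ms|ms] := boolP (m \in s); last first.
  rewrite big_seq big1 ?ler01 // => n ns; rewrite mcoeffX.
  by case: eqP ns ms => [-> ->|]; rewrite ?normr0.
rewrite (bigD1_seq m) //= mcoeffX eqxx normr1 big1 ?addr0 // => n.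
by rewrite mcoeffX eq_sym => /negPf ->; rewrite normr0.
Qed.

Lemma deg_l1_le_sum (I : Type) (s : seq I) (F : I -> V) h (M : I -> C) :
  (forall i, deg_l1_le (F i) h (M i)) ->
  deg_l1_le (\sum_(i <- s) F i) h (\sum_(i <- s) M i).
Proof.
move=> Fs; elim: s => [|i s IHs]; first by rewrite !big_nil; exact: deg_l1_le0.
by rewrite !big_cons; exact: deg_l1_leD.
Qed.

(** Polynomial growth on the monomial basis together with a bounded increase of
the degree; the latter is what makes the class closed under composition. *)
Definition tame W : Prop := exists B k h, 0 <= B /\
  forall m, deg_l1_le (W (basis R m)) (mdeg m + h) (B * (mdeg m).+1%:R ^+ k).

Lemma basis_expansion v :
  v = \sum_(n <- msupp v) coord n v *: basis R n.
Proof. exact: mpolyE. Qed.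

Lemma tame1 : tame 1.
Proof.
exists 1, 0%N, 0%N; split=> // m.
by rewrite expr0 mulr1 addn0; exact: deg_l1_le_basis.
Qed.

Lemma tameD W X : tame W -> tame X -> tame (W + X).
Proof.
move=> [B1 [k1 [h1 [B10 W1]]]] [B2 [k2 [h2 [B20 W2]]]].
exists (B1 + B2), (maxn k1 k2), (maxn h1 h2); split=> [|m].
  exact: addr_ge0.
have le1 k : (k <= maxn k1 k2)%N -> (mdeg m).+1%:R ^+ k <= (mdeg m).+1%:R ^+ maxn k1 k2 :> C.
  by move=> kk; apply: ler_weXn2l kk; rewrite ler1n.
rewrite mulrDl; apply: deg_l1_leD.
  apply: (deg_l1_le_weaken (W1 m)); first by rewrite leq_add2l leq_maxl.
  by apply: ler_wpM2l => //; apply: le1; rewrite leq_maxl.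
apply: (deg_l1_le_weaken (W2 m)); first by rewrite leq_add2l leq_maxr.
by apply: ler_wpM2l => //; apply: le1; rewrite leq_maxr.
Qed.

Lemma tameZ c W : tame W -> tame (c *: W).
Proof.
move=> [B [k [h [B0 Wm]]]]; exists (`|c| * B), k, h; split=> [|m].
  by rewrite mulr_ge0.
by rewrite -mulrA; exact: deg_l1_leZ.
Qed.

Lemma tameM W X : tame W -> tame X -> tame (W * X).
Proof.
move=> [B1 [k1 [h1 [B10 W1]]]] [B2 [k2 [h2 [B20 X2]]]].
exists (B1 * h2.+1%:R ^+ k1 * B2), (k1 + k2)%N, (h2 + h1)%N.
split=> [|m]; first by rewrite !mulr_ge0 // exprn_ge0.
have [Xh XM] := X2 m; set v := X (basis R m).
rewrite endoME -/v (basis_expansion v) linear_sum /=.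
have Wn n : deg_l1_le (coord n v *: W (basis R n)) (mdeg m + (h2 + h1))
    (`|coord n v| * (B1 * (mdeg m + h2).+1%:R ^+ k1)).
  have [nh|nh] := ltnP (mdeg m + h2) (mdeg n).
    by rewrite (Xh _ nh) scale0r normr0 mul0r; exact: deg_l1_le0.
  apply: deg_l1_leZ; apply: (deg_l1_le_weaken (W1 n)); first by rewrite addnA leq_add2r.
  apply: ler_wpM2l => //; apply: lerXn2r; rewrite ?nnegrE ?ler0n //.
  by rewrite ler_nat ltnS.
under eq_bigr do rewrite linearZ /=.
apply: (deg_l1_le_weaken (deg_l1_le_sum (msupp v) Wn)) => //.
rewrite -mulr_suml.
have step : B1 * (mdeg m + h2).+1%:R ^+ k1 <= B1 * h2.+1%:R ^+ k1 * (mdeg m).+1%:R ^+ k1.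
  rewrite -mulrA -exprMn; apply: ler_wpM2l => //.
  apply: lerXn2r; rewrite ?nnegrE ?mulr_ge0 ?ler0n //.
  by rewrite -natrM ler_nat mulSn mulnS -addSn leq_add2l leq_addr.
have vM := XM (msupp v) (msupp_uniq v).
apply: le_trans (ler_pM _ _ vM step) _.
- by apply: sumr_ge0 => n _.
- by rewrite mulr_ge0 // exprn_ge0.
by rewrite exprD le_eqVlt; apply/orP; left; apply/eqP; ring.
Qed.

Lemma tame_cre p : tame (cre R p).
Proof.
exists 1, 0%N, 1%N; split=> // m; rewrite expr0 mulr1.
have -> : cre R p (basis R m) = basis R (mnm_add (mnm1 (enum_rank p)) m).
  by rewrite /basis mpolyXD.
by have := deg_l1_le_basis (mnm_add (mnm1 (enum_rank p)) m); rewrite mdegD mdeg1 addnC.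
Qed.

Lemma tame_ann p : tame (ann R p).
Proof.
exists 1, 1%N, 0%N; split=> // m; rewrite expr1 mul1r addn0.
rewrite /ann /= mderivX.
apply: (deg_l1_le_weaken (deg_l1_leZ _ (deg_l1_le_basis _))); first exact: mdegB.
rewrite mulr1 normr_nat ler_nat leqW // mdegE (bigD1 (enum_rank p)) //=.
exact: leq_addr.
Qed.

Definition twisted_trace (d : state -> C) W : C :=
  summability.sum (fun m : state => d m * coord m (W (basis R m)) : C^o).

Section TwistedTrace.
Variables (d : state -> C) (q : R) (D : C).
Hypothesis q01 : 0 <= q < 1.
Hypothesis dq : forall m, `|d m| <= D * (q ^+ mdeg m)%:C%C.

(** Half of the decay, s = sqrt q, absorbs the polynomial growth and the other
half is summed over the monomials. *)
Lemma twisted_trace_sums W : tame W ->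
  sums_to (fun m => d m * coord m (W (basis R m))) (twisted_trace d W).
Proof.
move=> [B [k [h [B0 WB]]]].
suff /abs_bounded_sums_to[l hl] : abs_bounded (fun m => d m * coord m (W (basis R m))).
  by rewrite /twisted_trace (sums_to_sum hl).
have [/andP[q0 q1]] := q01.
pose s := Num.sqrt q; have ss : s * s = q by rewrite -expr2 sqr_sqrtr.
have s0 : 0 <= s by exact: sqrtr_ge0.
have s1 : s < 1 by rewrite -sqrtr1 ltr_sqrt.
have s01 : 0 <= s < 1 by rewrite s0.
have [B' kB'] := poly_geometric_bounded k s01.
have D0 : 0 <= D.
  by have := le_trans (normr_ge0 _) (dq mnm0); rewrite mdeg0 expr0 mulr1.
exists (D * B * B'%:C%C * ((1 - s)^-1 ^+ #|osc r|)%:C%C) => A.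
have B'0 : 0 <= B'.
  by apply: le_trans (kB' 0%N); rewrite mulr_ge0 // exprn_ge0.
apply: (@le_trans _ _ (\sum_(m <- A) (D * B * B'%:C%C) * (s ^+ mdeg m)%:C%C)).
  apply: ler_sum => m _; rewrite normrM.
  apply: le_trans (ler_pM _ _ (dq m) (deg_l1_le_coord m (WB m))) _ => //.
  have -> : D * (q ^+ mdeg m)%:C%C * (B * (mdeg m).+1%:R ^+ k) =
      D * B * ((mdeg m).+1%:R ^+ k * s ^+ mdeg m)%:C%C * (s ^+ mdeg m)%:C%C.
    have -> : (mdeg m).+1%:R ^+ k = ((mdeg m).+1%:R ^+ k)%:C%C :> C.
      by rewrite rmorphXn /= rmorph_nat.
    rewrite -ss exprMn !(rmorphM (real_complex R)) /=.
    by rewrite mulrACA -[RHS]mulrA; congr (_ * _); rewrite mulrC mulrA.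
  apply: ler_wpM2r; first by rewrite lecR exprn_ge0.
  by apply: ler_wpM2l; rewrite ?mulr_ge0 // lecR.
rewrite -mulr_sumr; apply: ler_wpM2l; first by rewrite !mulr_ge0 // lecR.
rewrite -(raddf_sum (real_complex R)) lecR.
by apply: sum_multinom_le => //; exact: fset_uniq.
Qed.

Lemma twisted_trace_linear : linear_on tame (twisted_trace d).
Proof.
split; [exact: tame1|exact: tameD|exact: tameM|exact: tameZ| |].
- move=> W X tW tX; apply: sums_to_sum.
  have := sums_toD (twisted_trace_sums tW) (twisted_trace_sums tX).
  by congr sums_to; apply/funext => m; rewrite endoDE coordD mulrDr.
- move=> c W tW; apply: sums_to_sum.
  have := @sums_toZ _ _ c _ _ (twisted_trace_sums tW).
  by congr sums_to; apply/funext => m; rewrite endoZE coordZ mulrCA.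
Qed.

End TwistedTrace.
End Tame.

(** * Twisted cyclicity of the Fock trace *)

Section Generators.
Variables (R : realType) (r : nat).
Local Notation C := R[i].
Local Notation V := (Fock R r).
Local Notation state := (state r).
Implicit Types (m n : state) (v : V) (W X : endo V) (p : osc r).

Definition raise p m : state := mnm_add m (mnm1 (enum_rank p)).
Definition lower p m : state := mnm_sub m (mnm1 (enum_rank p)).

Lemma raiseK p : cancel (raise p) (lower p).
Proof. by move=> m; rewrite /raise /lower addmK. Qed.

Lemma lowerK p : {in [pred m : state | 0 < m (enum_rank p)]%N, cancel (lower p) (raise p)}.
Proof. by move=> m /= mp; rewrite /raise /lower submK // lep1mP -lt0n. Qed.

Lemma raise_pos p m : (0 < raise p m (enum_rank p))%N.
Proof. by rewrite /raise mnmDE mnm1E eqxx addn1. Qed.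

Lemma cre_basis p m : cre R p (basis R m) = basis R (raise p m).
Proof. by rewrite /basis /raise mpolyXD [RHS]mulrC. Qed.

Lemma ann_basis p m :
  ann R p (basis R m) = (m (enum_rank p))%:R *: basis R (lower p m).
Proof. by rewrite /ann /= mderivX. Qed.

Lemma coord_ann p m v :
  coord m (ann R p v) = (m (enum_rank p)).+1%:R * coord (raise p m) v.
Proof. by rewrite /coord /ann /= mcoeff_mderiv [RHS]mulr_natl. Qed.

Lemma coord_cre_raise p m v : coord (raise p m) (cre R p v) = coord m v.
Proof. by rewrite /coord /cre /= /cre_fun mulrC /raise addmC mcoeffMX. Qed.

Lemma coord_cre0 p m v : m (enum_rank p) = 0%N -> coord m (cre R p v) = 0.
Proof.
move=> mp; apply: memN_msupp_eq0; rewrite /cre /= /cre_fun mulrC.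
rewrite (perm_mem (msuppMX _ _)); apply/mapP => -[n _ e].
by move: mp; rewrite e mnmDE mnm1E eqxx.
Qed.

Section Trace.
Variables (d : state -> C) (q : R) (D : C) (c : osc r -> C).
Hypothesis q01 : 0 <= q < 1.
Hypothesis dq : forall m, `|d m| <= D * (q ^+ mdeg m)%:C%C.
Hypothesis dc : forall p m, d (raise p m) = c p * d m.
Hypothesis c0 : forall p, c p != 0.

Let reindex p (g : state -> C) l :
  (forall m, m (enum_rank p) = 0%N -> g m = 0) ->
  sums_to (g \o raise p) l -> sums_to g l.
Proof.
move=> g0; apply: (sums_to_reindex (raiseK p) (raise_pos p) (@lowerK p)) => m.
by rewrite -leqNgt leqn0 => /eqP /g0.
Qed.

(** Both traces are sums over monomials m of the coefficient of W from m + e_p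
to m, weighted by d(m + e_p) and d(m) respectively. *)
Lemma cre_twists p : twists (@tame R r) (twisted_trace d) (c p) (cre R p).
Proof.
split=> [|W tW]; first exact: tame_cre.
have tc := tameM tW (tame_cre R p).
apply: sums_to_sum; apply: (reindex (p := p)) => [m mp|].
  by rewrite endoME coord_cre0 ?mulr0.
have := @sums_toZ _ _ (c p) _ _ (twisted_trace_sums q01 dq tc).
congr sums_to; apply/funext => m; rewrite [RHS]/comp.
by rewrite !endoME coord_cre_raise cre_basis dc mulrA.
Qed.

Lemma ann_twists p : twists (@tame R r) (twisted_trace d) (c p)^-1 (ann R p).
Proof.
split=> [|W tW]; first exact: tame_ann.
have ta := tameM (tame_ann R p) tW.
apply: (@mulfI _ (c p)) => //; rewrite mulrA divff // mul1r; apply/esym.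
apply: sums_to_sum; apply: (reindex (p := p)) => [m mp|].
  by rewrite endoME ann_basis mp scale0r linear0 /coord mcoeff0 mulr0.
have := @sums_toZ _ _ (c p) _ _ (twisted_trace_sums q01 dq ta).
congr sums_to; apply/funext => m; rewrite [RHS]/comp.
rewrite !endoME coord_ann ann_basis raiseK linearZ /= coordZ dc.
by rewrite /raise mnmDE mnm1E eqxx addn1 !mulrA.
Qed.

End Trace.

Section Spectrum.
Variables (mu : signs r) (t : C).
Local Notation a := (flip_a mu (@ann R r) (@cre R r)).
Local Notation ab := (flip_abar mu (@ann R r) (@cre R r)).

(** The eigenvalue is read off as a coordinate, as in [exp_diag]. *)
Definition F_eigen (i : 'I_r) (m : state) : C :=
  coord m (F_op mu t (lshift r i) (lshift r i) (basis R m)).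

Definition signC (b : bool) : C := (-1) ^+ b.

Let touches (i : 'I_r) p : C := (i == (val p).1)%:R + (i == (val p).2)%:R.

Lemma F_op_lshift i : exists c : C,
  F_op mu t (lshift r i) (lshift r i) = c%:A - signC (mu i) *: number_op a ab i i.
Proof.
rewrite /F_op /F_sign mxE Lax_sign_entry /flip_index label_lshift.
case mi: (mu i).
  rewrite -[rev_ord _]/(primed i) (Lax_dr (flip_ccr mu (fock_ccr R r))).
  by eexists; rewrite /signC expr1 scaleN1r opprK; reflexivity.
by rewrite Lax_ul; eexists; rewrite /signC expr0 scale1r; reflexivity.
Qed.

Lemma number_op_cre i p :
  number_op a ab i i * cre R p - cre R p * number_op a ab i i =
  (signC (mu (val p).1) * touches i p) *: cre R p.
Proof.
have cc := flip_ccr mu (fock_ccr R r).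
have [p' [ep antip]] := antisym_lt (endo V) (valP p).
have {ep}e : p' = p by apply/val_inj; rewrite ep; case: (val p).
subst p'; rewrite /touches /signC; set k := (val p).1; set l := (val p).2.
have dE (g : osc r -> endo V) (j j' : 'I_r) :
    (i == j)%:R *: antisym g i j' = (i == j)%:R *: antisym g j j' :> endo V.
  by case: eqP => [->|]; rewrite ?scale0r.
have -> : cre R p = if mu k then antisym a k l else antisym ab k l.
  by rewrite !(antip _).1 /flip_a /flip_abar -/k; case: (mu k).
case: (mu k); [rewrite (comm_K_al cc)|rewrite (comm_K_be cc)]; rewrite !dE.
  rewrite (antisymN a l) scalerN expr1 mulN1r -opprD addrC -scalerDl scaleNr.
  by rewrite addrC.
by rewrite (antisymN ab l) scalerN opprK -scalerDl expr0 mul1r.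
Qed.

(** The creation operator of p is a root vector of weight
- eps_k - mu_k mu_l eps_l for p = (k, l). *)
Lemma F_eigen_raise i p m :
  F_eigen i (raise p m) =
  F_eigen i m - signC (mu i) * signC (mu (val p).1) * touches i p.
Proof.
have [c Fc] := F_op_lshift i.
have comm : F_op mu t (lshift r i) (lshift r i) * cre R p
    - cre R p * F_op mu t (lshift r i) (lshift r i) =
    - (signC (mu i) * signC (mu (val p).1) * touches i p) *: cre R p.
  rewrite Fc comm_algl -scalerAl -scalerAr -scalerBr number_op_cre.
  by rewrite scalerA mulrA scaleNr.
have [e Fe] := F_op_diagonal mu t (lshift r i) m.
have := congr1 (fun X : endo V => coord (raise p m) (X (basis R m))) comm.
rewrite endoDE endoNE endoZE !endoME cre_basis coordD coordZ.
rewrite Fe linearZ /= cre_basis -scaleN1r !coordZ -/(F_eigen i (raise p m)).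
have cb n : coord n (basis R n) = 1 by rewrite /coord mcoeffX eqxx.
rewrite cb !mulr1 mulN1r => /eqP; rewrite subr_eq => /eqP ->.
by rewrite /F_eigen Fe coordZ cb mulr1 addrC.
Qed.

End Spectrum.

Lemma cexpD (z w : C) : cexp (z + w) = cexp z * cexp w.
Proof.
case: z w => [z1 z2] [w1 w2]; rewrite /cexp /= expRD trigo.cosD trigo.sinD.
by apply/eqP; rewrite eq_complex /=; apply/andP; split; apply/eqP; ring.
Qed.

Lemma cexp0 : cexp (0 : C) = 1.
Proof. by rewrite /cexp /= expR0 trigo.cos0 trigo.sin0 mulr0 mulr1. Qed.

Lemma cexpN (z : C) : cexp (- z) = (cexp z)^-1.
Proof.
have e : cexp (- z) * cexp z = 1 by rewrite -cexpD addNr cexp0.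
have z0 : cexp z != 0 by apply: contra_eq_neq e => ->; rewrite mulr0 eq_sym oner_eq0.
by rewrite -[LHS]mulr1 -(divff z0) mulrA e mul1r.
Qed.

Lemma cexp_neq0 (z : C) : cexp z != 0.
Proof.
have e : cexp (- z) * cexp z = 1 by rewrite -cexpD addNr cexp0.
by apply: contra_eq_neq e => ->; rewrite mulr0 eq_sym oner_eq0.
Qed.

Lemma cexp_sum (I : finType) (F : I -> C) :
  cexp (\sum_i F i) = \prod_i cexp (F i).
Proof. by apply: (big_morph _ cexpD cexp0). Qed.

Section Twist.
Variables (xs : 'I_r -> C) (mu : signs r) (t : C).

Definition twist_op : endo V :=
  \prod_(i < r) exp_diag (xs i) (F_op mu t (lshift r i) (lshift r i)).

Definition twist (m : state) : C :=
  \prod_(i < r) cexp (xs i * F_eigen mu t i m).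

Lemma coord_twist_op m v : coord m (twist_op v) = twist m * coord m v.
Proof.
rewrite /twist_op /twist; elim: (index_enum _) v => [|i s IHs] v.
  by rewrite !big_nil mul1r.
rewrite !big_cons endoME coord_exp_diag IHs /F_eigen.
by rewrite mulrC mulrA.
Qed.

(** The weight tau_i^(mu_i) that corresponds to eps_i before reflection. *)
Definition twist_weight (i : 'I_r) : C := cexp (signC (mu i) * xs i).

(** With tau reflected by mu as above, the creation operator of p = (k, l) acts
as abar_{k,l'} if mu_k = 1 and as a_{l',k} if mu_k = - 1. *)
Definition osc_weight (p : osc r) : C :=
  (if mu (val p).1 then id else GRing.inv)
    (twist_weight (val p).1 * twist_weight (val p).2).

Lemma twist_raise p m : twist (raise p m) = osc_weight p * twist m.
Proof.
rewrite /twist -!cexp_sum.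
under eq_bigr do rewrite F_eigen_raise mulrBr.
rewrite sumrB cexpD mulrC; congr (_ * _).
set k := (val p).1; set l := (val p).2.
have -> : - (\sum_(i < r) xs i * (signC (mu i) * signC (mu k) * ((i == k)%:R + (i == l)%:R)))
    = - (signC (mu k) * (signC (mu k) * xs k + signC (mu l) * xs l)).
  have pick (j : 'I_r) : \sum_(i < r) (i == j)%:R * (signC (mu i) * xs i) = signC (mu j) * xs j.
    rewrite (bigD1 j) //= eqxx mul1r big1 ?addr0 // => i /negPf ->.
    by rewrite mul0r.
  rewrite -!pick -big_split mulr_sumr; congr (- _); apply: eq_bigr => i _ /=.
  rewrite -mulrDl; move: (_ + _) (signC _) (signC _) (xs i) => T A B x.
  ring.
rewrite /osc_weight -/k -/l /twist_weight -cexpD /signC; case: (mu k).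
  by rewrite expr1 !mulN1r opprK.
by rewrite expr0 !mul1r cexpN.
Qed.

Hypothesis xs_decr : forall i j : 'I_r, (i < j)%N -> `|cexp (xs j)| < `|cexp (xs i)|.
Hypothesis xs_gt1 : forall i : 'I_r, 1 < `|cexp (xs i)|.

(** The exponent of tau_k is - 1 whatever the signs are, and |tau_k| exceeds
|tau_l| and 1, hence wins against tau_l or its inverse. *)
Lemma osc_weight_lt1 p : `|osc_weight p| < 1.
Proof.
rewrite /osc_weight /twist_weight /signC.
have kl : ((val p).1 < (val p).2)%N by exact: (valP p).
set k := (val p).1 in kl *; set l := (val p).2 in kl *.
have xk0 : 0 < `|cexp (xs k)| by rewrite normr_gt0 cexp_neq0.
have xl0 : 0 < `|cexp (xs l)| by rewrite normr_gt0 cexp_neq0.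
case: (mu k); case: (mu l);
  rewrite ?expr1 ?expr0 ?mulN1r ?mul1r ?cexpN ?invfM ?invrK !normrM ?normfV.
- by rewrite mulr_ilt1 ?invr_ge0 ?ltW // invf_lt1.
- by rewrite mulrC ltr_pdivrMr // mul1r xs_decr.
- by rewrite mulrC ltr_pdivrMr // mul1r xs_decr.
- by rewrite mulr_ilt1 ?invr_ge0 ?ltW // invf_lt1.
Qed.

Lemma twist_bound : exists q : R, 0 <= q < 1 /\
  forall m, `|twist m| <= `|twist mnm0| * (q ^+ mdeg m)%:C%C.
Proof.
pose q : R := \big[Num.max/0]_p complex.Re `|osc_weight p|.
have normRe (z : C) : (complex.Re `|z|)%:C%C = `|z| by rewrite RRe_real ?normr_real.
have wq p : `|osc_weight p| <= q%:C%C.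
  by rewrite -normRe lecR; apply: le_bigmax.
have q0 : 0 <= q by exact: bigmax_ge_id.
exists q; split=> [|m].
  rewrite q0 /=; apply/bigmax_ltP; split=> // p _.
  by rewrite -ltcR normRe osc_weight_lt1.
have [n] := ubnP (mdeg m); elim: n m => // n IHn m mn.
have [m0|m0] := posnP (mdeg m).
  move/eqP: (m0); rewrite mdeg_eq0 => /eqP ->.
  by rewrite mdeg0 expr0 mulr1.
have [j mj] : exists j, (0 < m j)%N.
  apply/existsP; rewrite -[[exists _, _]]negbK negb_exists; apply/negP => /forallP mz.
  move: m0; rewrite mdegE big1 // => j _.
  by have := mz j; rewrite -eqn0Ngt => /eqP.
pose p := enum_val j.
have em : raise p (lower p m) = m by apply: lowerK; rewrite inE /p enum_valK.
have dm : mdeg m = (mdeg (lower p m)).+1.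
  by rewrite -{1}em /raise mdegD mdeg1 addn1.
rewrite -{1}em twist_raise normrM dm exprS rmorphM mulrCA.
apply: ler_pM => //; apply: IHn.
by move: mn; rewrite dm ltnS.
Qed.

Lemma fock_traceE W : fock_trace (twist_op * W) = twisted_trace twist W.
Proof.
rewrite /fock_trace /twisted_trace (_ : (fun m => coord m _) =
  fun m => twist m * coord m (W (basis R m))) //.
by apply/funext => m; rewrite endoME coord_twist_op.
Qed.

Lemma osc_weight_neq0 p : osc_weight p != 0.
Proof.
by rewrite /osc_weight; case: ifP => _; rewrite ?invr_eq0 mulf_neq0 ?cexp_neq0.
Qed.

Lemma trace_linear : linear_on (@tame R r) (twisted_trace twist).
Proof. by have [q [q01 dq]] := twist_bound; exact: (twisted_trace_linear q01 dq). Qed.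

Local Notation a := (flip_a mu (@ann R r) (@cre R r)).
Local Notation ab := (flip_abar mu (@ann R r) (@cre R r)).
Local Notation tw := (twists (@tame R r) (twisted_trace twist)).

Lemma osc_twists p :
  tw (twist_weight (val p).1 * twist_weight (val p).2) (a p) /\
  tw (twist_weight (val p).1 * twist_weight (val p).2)^-1 (ab p).
Proof.
have [q [q01 dq]] := twist_bound.
have := cre_twists q01 dq twist_raise p.
have := ann_twists q01 dq twist_raise osc_weight_neq0 p.
rewrite /flip_a /flip_abar /osc_weight; case: (mu (val p).1) => ta tc; split=> //.
- exact: (twistsN trace_linear ta).
- by rewrite invrK in ta.
Qed.

Lemma antisym_twists i j :
  tw (twist_weight i * twist_weight j) (antisym a i j) /\
  tw (twist_weight i * twist_weight j)^-1 (antisym ab i j).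
Proof.
have half (k l : 'I_r) : (k < l)%N -> tw (twist_weight k * twist_weight l) (antisym a k l) /\
  tw (twist_weight k * twist_weight l)^-1 (antisym ab k l).
  move=> kl; have [p [ep antip]] := antisym_lt (endo V) kl.
  by rewrite !(antip _).1; have := osc_twists p; rewrite ep.
have [ij|ji|/val_inj ->] := ltngtP i j; first exact: half.
  rewrite mulrC (antisymN a i) (antisymN ab i); have [ta tb] := half _ _ ji.
  by split; exact: (twistsN trace_linear).
by rewrite !antisym_diag; split; exact: (twists0 trace_linear).
Qed.

Definition label_weight (p : 'I_(r + r)) : C :=
  weight twist_weight (flip_index mu p).

(** The permutation of labels by B_mu undoes the reflection of the weights, so
that the scalars of the twisted cyclicity do not depend on mu. *)
Lemma label_weightE i : label_weight (lshift r i) = cexp (xs i) /\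
  label_weight (primed i) = (cexp (xs i))^-1.
Proof.
rewrite /label_weight /flip_index label_lshift label_primed /twist_weight.
case mi: (mu i); rewrite -?[rev_ord (lshift _ _)]/(primed _) ?rev_ordK.
  by rewrite weight_lshift weight_primed mi /signC expr1 mulN1r cexpN invrK.
by rewrite weight_lshift weight_primed mi /signC expr0 mul1r.
Qed.

(** The weights tau_i have distinct norms above 1, and their inverses have
distinct norms below 1. *)
Lemma label_weight_inj : injective label_weight.
Proof.
have xinj (i j : 'I_r) : `|cexp (xs i)| = `|cexp (xs j)| -> i = j.
  move=> e; have [ij|ji|/val_inj //] := ltngtP i j.
    by have := xs_decr ij; rewrite e ltxx.
  by have := xs_decr ji; rewrite e ltxx.
have xsep (i j : 'I_r) : `|cexp (xs i)| <> `|cexp (xs j)|^-1.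
  move=> e; have := xs_gt1 i; rewrite e invf_gt1 ?normr_gt0 ?cexp_neq0 //.
  by move=> /lt_trans/(_ (xs_gt1 j)); rewrite ltxx.
move=> p p'; case: (labelP p) => ->; case: (labelP p') => -> /(congr1 Num.norm);
  rewrite ?(label_weightE _).1 ?(label_weightE _).2 ?normfV.
- by move/xinj ->.
- by move/xsep.
- by move/esym/xsep.
- by move/invr_inj/xinj ->.
Qed.

Lemma Lax_sign_twists x (p p' : 'I_(r + r)) :
  tw (label_weight p' / label_weight p) (Lax_sign mu t x (@ann R r) (@cre R r) p p').
Proof.
rewrite Lax_sign_entry; apply: Lax_twists.
- exact: trace_linear.
- exact: flip_ccr (fock_ccr R r).
- by move=> i; exact: cexp_neq0.
- by move=> i j; case: (antisym_twists i j).
- by move=> i j; case: (antisym_twists i j).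
Qed.

End Twist.

End Generators.

(** * Invariance of the transfer matrices *)

Section Termwise.
Variables (R : realType) (r N : nat) (xs : 'I_r -> R[i]).
Local Notation C := R[i].
Hypothesis xs_decr : forall i j : 'I_r, (i < j)%N -> `|cexp (xs j)| < `|cexp (xs i)|.
Hypothesis xs_gt1 : forall i : 'I_r, 1 < `|cexp (xs i)|.

Lemma F_opE mu (t : C) (i j : 'I_(r + r)) :
  F_op mu t i j = Lax_sign mu t 0 (@ann R r) (@cre R r) j i.
Proof. by rewrite /F_op /F_sign mxE. Qed.

Lemma F_op_opposite mu (t : C) (i : 'I_(r + r)) :
  F_op mu t i i = F_op (opposite mu) (reflected_spin r t) i i.
Proof.
apply: etrans (F_opE _ _ _ _) _; apply: etrans (esym (F_opE _ _ _ _)).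
exact: (Lax_sign_diag_opposite (fock_ccr R r)).
Qed.

Lemma F_eigen_opposite mu (t : C) (i : 'I_r) m :
  F_eigen (opposite mu) (reflected_spin r t) i m = F_eigen mu t i m.
Proof.
exact: (congr1 (fun X : endo (Fock R r) => coord m (X (basis R m)))
  (esym (F_op_opposite mu t (lshift r i)))).
Qed.

Lemma twist_opposite mu t :
  twist xs (opposite mu) (reflected_spin r t) = twist xs mu t.
Proof.
by apply/funext => m; apply: eq_bigr => i _; rewrite F_eigen_opposite.
Qed.

Lemma T_signE mu t x p q :
  T_sign N xs mu t x p q = twisted_trace (twist xs mu t)
    (\prod_(j <- [seq (tnth (enum_val p) k, tnth (enum_val q) k) | k <- index_enum 'I_N])
       Lax_sign mu t x (@ann R r) (@cre R r) j.1 j.2).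
Proof.
apply: etrans (mxE _ _ _ _) _.
apply: etrans (fock_traceE _ _ _ _) _.
by congr twisted_trace; rewrite big_map.
Qed.

(** The two terms are values of one functional, since the twists agree, on words
in two families with the same brackets, weights and diagonal entries. *)
Lemma T_sign_opposite mu t x :
  T_sign N xs mu t x = T_sign N xs (opposite mu) (reflected_spin r t) x.
Proof.
apply/matrixP => p q; apply: etrans (T_signE _ _ _ _ _) _.
apply: etrans (esym (T_signE _ _ _ _ _)); rewrite twist_opposite.
have lin := trace_linear mu t xs_decr xs_gt1.
have lw : label_weight xs (opposite mu) =1 label_weight xs mu.
  by move=> j; case: (labelP j) => ->;
    rewrite ?(label_weightE _ _ _).1 ?(label_weightE _ _ _).2.
pose c (jk : 'I_(r + r) * 'I_(r + r)) := label_weight xs mu jk.2 / label_weight xs mu jk.1.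
pose M nu u (jk : 'I_(r + r) * 'I_(r + r)) :=
  Lax_sign nu u x (@ann R r) (@cre R r) jk.1 jk.2.
have Mb nu u : brackets (@so_bracket C r) (M nu u).
  exact: Lax_sign_brackets (fock_ccr R r).
have tM jk : twists (@tame R r) (twisted_trace (twist xs mu t)) (c jk) (M mu t jk).
  exact: Lax_sign_twists.
have tM' jk : twists (@tame R r) (twisted_trace (twist xs mu t)) (c jk)
    (M (opposite mu) (reflected_spin r t) jk).
  by rewrite -twist_opposite /c -!lw; exact: Lax_sign_twists.
apply: (twisted_trace_eq lin (Mb mu t) (Mb _ _) tM tM') => -[j k] cjk.
have e : k = j.
  have inj : injective (label_weight xs mu) by exact: label_weight_inj.
  apply: inj; rewrite -[RHS]mul1r -cjk /c /=.
  rewrite divfK //.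
  by case: (labelP j) => ->; rewrite ?(label_weightE _ _ _).1 ?(label_weightE _ _ _).2
    ?invr_eq0 cexp_neq0.
by rewrite e; exact: (Lax_sign_diag_opposite (fock_ccr R r)).
Qed.

End Termwise.

Lemma ell_opposite r (mu : signs r) :
  (ell mu + ell (opposite mu) = (r * (r - 1))./2)%N.
Proof.
(* the two sums complement each other in the sum of all r - i, that is, of all j < r *)
rewrite /ell [X in (_ + X)%N](eq_bigl (fun i => ~~ mu i)); last by move=> i; rewrite ffunE.
rewrite -(bigID mu xpredT) /= (reindex_inj rev_ord_inj) /=.
rewrite (eq_bigr (fun i : 'I_r => i : nat)); last first.
  by move=> i _; rewrite subnSK ?leq_subr //; rewrite subKn // ltnW.
by rewrite -(big_mkord xpredT (fun i => i)) bin2_sum bin2 subn1.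
Qed.

Lemma parity_opposite r (mu : signs r) (s : bool) :
  (\prod_(i < r) (-1) ^+ opposite mu i == (-1) ^+ (s (+) odd r) :> int) =
  (\prod_(i < r) (-1) ^+ mu i == (-1) ^+ s :> int).
Proof.
have -> : \prod_(i < r) (-1) ^+ opposite mu i =
    (-1) ^+ odd r * \prod_(i < r) (-1) ^+ mu i :> int.
  rewrite signr_odd -[X in (-1) ^+ X]card_ord -prodr_const -big_split /=.
  by apply: eq_bigr => i _; rewrite ffunE; case: (mu i).
by rewrite addbC signr_addb (inj_eq (mulfI (negbT (signr_eq0 _ _)))).
Qed.

Theorem proposition6p52 (R : realType) (r N : nat) (xs : 'I_r -> R[i])
  (r_ge2 : (2 <= r)%N)
  (tau_decr : forall i j : 'I_r,
     (i < j)%N -> `|cexp (xs j)| < `|cexp (xs i)|)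
  (tau_gt1 : forall i : 'I_r, 1 < `|cexp (xs i)|)
  (s : bool) (t x : R[i]) :
  T_spin N xs s t x =
  (-1) ^+ (r * (r - 1))./2 *: T_spin N xs (s (+) odd r) (- r%:R + 1 - t) x.
Proof.
rewrite /T_spin scaler_sumr [RHS](reindex_inj (inv_inj (@oppositeK r))) /=.
apply: eq_big => [mu|mu _]; first by rewrite parity_opposite.
rewrite (T_sign_opposite N tau_decr tau_gt1) scalerA -(ell_opposite mu) exprD.
by rewrite -mulrA -expr2 sqrr_sign mulr1.
Qed.
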